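(* Let $T$ be an acyclic locally countable mcp Borel graph on a standard probability space $(X,\mu)$, with associated Radon--Nikodym cocycle $\rho:E_T\to(0,\infty)$. The following are equivalent: (1) $E_T$ is smooth on a conull set. (2) All ends of $T$ in a.e. $T$-component are $\rho$-abarytropic. (3) All ends of $T$ in a.e. $T$-component are $\rho$-vanishing.
   Context: A countable Borel equivalence relation $E$ on $X$ is mcp on $(X,\mu)$ if the $E$-saturation of every null set is null; it is smooth if it admits a Borel transversal. Its Radon--Nikodym cocycle is the (unique up to null sets) Borel $\rho:E\to(0,\infty)$ with $\rho(z,y)\rho(y,x)=\rho(z,x)$ and, writing $\rho^x(y):=\rho(y,x)$, $\int_X\sum_{y\in[x]_E}h(x,y)\,d\mu(x)=\int_X\sum_{y\in[x]_E}h(y,x)\rho^x(y)\,d\mu(x)$ for all Borel $h:E\to[0,\infty]$. A set $D\subseteq[x]_E$ is $\rho$-finite if $\sum_{y\in D}\rho^x(y)<\infty$ (independent of $x$ in the class). A graph on $X$ is an irreflexive symmetric subset of $X^2$; locally countable means each vertex has countably many neighbors. $E_T$ is the connectedness equivalence relation of $T$; $T$ is mcp if $E_T$ is. A geodesic ray is an injective infinite path in $T$; ends are classes of rays modulo having a common tail. A half-space is a $T$-connected set $U\subseteq X$ with exactly one edge joining $U$ to $X\setminus U$; its closure $\overline U$ is $U$ together with all ends represented by rays in $U$. Vertices $y$ converge to an end $\xi$ if they are eventually in every half-space $U$ with $\xi\in\overline U$. An end $\xi$ of $[x]_{E_T}$ is $\rho$-vanishing if $\limsup_{y\to\xi}\rho^x(y)=0$;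 it is $\rho$-abarytropic if there is a $\rho$-finite half-space $U$ with $\xi\in\overline U$. *)

(* Defs.v *)
From mathcomp Require Import all_boot all_order all_algebra.
From mathcomp Require Import all_classical all_reals all_analysis.
From mathcomp Require Import measurable_realfun.
From Stdlib Require Import Relation_Operators.

Set Implicit Arguments.
Unset Strict Implicit.
Unset Printing Implicit Defensive.

Import Order.TTheory GRing.Theory Num.Theory.
Import numFieldNormedType.Exports.

Local Open Scope classical_set_scope.
Local Open Scope ring_scope.

(* A Polish space is presented by a complete compatible metric; in a Hausdorff
   pseudometric space of the library the distance separates points. *)
Definition polish_space (R : realType) (P : completePseudoMetricType R) : Prop :=
  hausdorff_space P /\ exists2 D : set P, countable D & dense D.

Definition standard_borel (R : realType) (d : measure_display)
    (X : measurableType d) : Prop :=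
  exists (P : completePseudoMetricType R) (f : X -> P),
    [/\ polish_space P, bijective f &
        forall A : set X, measurable A <-> <<s @open P >> (f @` A)].

Section relations.
Context {X : Type}.
Implicit Types (E T : set (X * X)) (x y : X) (A S U : set X).

Definition eclass E x : set X := [set y | E (x, y)].

Definition saturation E A : set X := \bigcup_(x in A) eclass E x.

Definition is_graph T : Prop :=
  (forall x, ~ T (x, x)) /\ (forall x y, T (x, y) -> T (y, x)).

Definition locally_countable T : Prop :=
  forall x, countable [set y | T (x, y)].

(* The vertices c 0, ..., c n of a cycle are pairwise distinct, and n >= 2. *)
Definition acyclic T : Prop :=
  ~ exists (n : nat) (c : nat -> X),
      [/\ (2 <= n)%N, {in [pred i | (i <= n)%N] &, injective c},
          forall i, (i < n)%N -> T (c i, c i.+1) & T (c n, c 0%N)].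

(* Connectedness of the subgraph of T induced on U. *)
Definition joined_in T U : X -> X -> Prop :=
  clos_refl_trans X (fun x y => [/\ U x, U y & T (x, y)]).

Definition connectedness T : set (X * X) :=
  [set p | joined_in T setT p.1 p.2].

Definition graph_connected T U : Prop :=
  forall x y, U x -> U y -> joined_in T U x y.

(* Each edge between U and its complement is listed once, oriented outwards. *)
Definition half_space T U : Prop :=
  graph_connected T U /\ exists! p : X * X, [/\ U p.1, ~ U p.2 & T p].

Definition ray T (r : nat -> X) : Prop :=
  injective r /\ forall n, T (r n, r n.+1).

Definition common_tail (r s : nat -> X) : Prop :=
  exists m n, forall k, r (m + k)%N = s (n + k)%N.

Definition end_of_ray T (r : nat -> X) : set (nat -> X) :=
  [set s | ray T s /\ common_tail r s].

(* xi is an end of the T-component of x. *)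
Definition end_at T x (xi : set (nat -> X)) : Prop :=
  exists r, [/\ ray T r, forall n, connectedness T (x, r n) &
                xi = end_of_ray T r].

(* xi belongs to the closure of U. *)
Definition end_in (xi : set (nat -> X)) U : Prop :=
  exists2 r, xi r & forall n, U (r n).

End relations.

(* The filter generated by the half-spaces U with xi in their closure: a net of
   vertices converges to xi iff it is eventually in every set of this filter. *)
Definition end_filter (X : choiceType) (T : set (X * X))
    (xi : set (nat -> X)) : set_system X :=
  filter_from
    (finI_from [set U : set X | half_space T U /\ end_in xi U] id) id.

Section measured.
Context {R : realType} {d : measure_display} {X : measurableType d}.
Implicit Types (mu : probability X R) (E T : set (X * X)) (rho : X * X -> R).

Definition mcp mu E : Prop :=
  forall N : set X, mu.-negligible N -> mu.-negligible (saturation E N).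

(* The restriction of E to some conull Borel set Y has a Borel transversal. *)
Definition smooth_ae mu E : Prop :=
  exists Y S : set X,
    [/\ measurable Y, mu (~` Y) = 0%E, measurable S, S `<=` Y &
        forall x, Y x -> exists! s, S s /\ E (x, s)].

(* rho (y, x) is the weight of y relative to x; only values on E matter. *)
Definition radon_nikodym_cocycle mu E rho : Prop :=
  [/\ measurable_fun E rho,
      forall p, E p -> 0 < rho p,
      forall x y z, E (x, y) -> E (y, z) ->
        rho (z, y) * rho (y, x) = rho (z, x) &
      forall h : X * X -> \bar R,
        measurable_fun E h -> (forall p, E p -> (0 <= h p)%E) ->
        ((\int[mu]_x (\esum_(y in eclass E x) h (x, y))) =
         (\int[mu]_x (\esum_(y in eclass E x) (h (y, x) * (rho (y, x))%:E))))%E].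

Definition rho_finite rho (x : X) (D : set X) : Prop :=
  (\esum_(y in D) (rho (y, x))%:E < +oo)%E.

Definition abarytropic T rho (x : X) (xi : set (nat -> X)) : Prop :=
  exists U : set X, [/\ half_space T U, end_in xi U & rho_finite rho x U].

(* limf_esup unfolded: the vertex set carries no filteredType structure. *)
Definition vanishing T rho (x : X) (xi : set (nat -> X)) : Prop :=
  ereal_inf [set ereal_sup ((fun y => (rho (y, x))%:E) @` V)
            | V in end_filter T xi] = 0%E.

End measured.

(* Main.v *)
Require Import Defs.
From mathcomp Require Import finmap.
From mathcomp Require Import all_boot all_order all_algebra.
From mathcomp Require Import all_classical all_reals all_analysis.
From mathcomp Require Import measurable_realfun.
From mathcomp Require Import lra.
From Stdlib Require Import Relation_Operators Operators_Properties.

(** Write [E] for the connectedness relation of [T] and, for vertices [v <> y] of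
    one component, write [branch T v y] for the component containing [y] of the
    forest minus [v]. The proof goes round the cycle (1), (2), (3), (1).

    From smoothness to abarytropic ends: by the mass transport principle
    ([mass_transport]), when every vertex sends mass 1 to at most one vertex of
    its class, almost every vertex receives a finite mass, measured with the
    weights of the cocycle. If every vertex sends its mass to the point of a
    transversal in its class, that point receives the total weight of the class,
    so almost every class has finite weight ([smooth_rho_finite]), and so has
    each of its half-spaces.

    From abarytropic to vanishing ends, in each component: a half-space of finite
    weight has finitely many vertices above any level, and the tails of a ray
    leave every finite set ([abarytropic_vanishing]).

    From vanishing ends to smoothness: call a subset of a class negligible if, for
    some level that infinitely many vertices of the class reach, only finitely
    many of these belong to the subset ([negligible_weight]). Negligible sets form
    an ideal. The small part of a vertex [v] is the union of the negligible
    branches at [v]. A vertex belongs to the non-negligible small part of at most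
    one vertex ([large_small_part_unique]), so by mass transport almost all
    non-negligible small parts have finite weight; but a set of finite weight is
    negligible. Hence almost all small parts are negligible, provided that the
    class has infinitely many vertices above some level. In that case one can
    follow non-negligible branches along a ray ([large_branch_ray]), and its end
    does not vanish. So in almost every class finitely many vertices lie above any
    given vertex ([ae_heavier_finite]); those of maximal weight form a finite
    nonempty set, from which one point is selected in a measurable way
    ([smooth_of_heavier_finite]).

    Measurability rests on a Lusin--Novikov theorem modulo null sets: a measurable
    subset of a product of standard Borel spaces with countable sections is, off a
    null set of first coordinates, a countable union of graphs of measurable
    functions ([lusin_novikov_ae]). Applied to [T] it enumerates almost every
    class by countably many measurable maps ([class_enumeration]). It does not
    make [E] measurable over the exceptional null set, and without measurability
    of [E] the cocycle identity, which quantifies over the functions measurable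
    on [E], holds for all nonnegative functions. That case is treated apart: the
    identity then implies smoothness ([smooth_of_nonmeasurable]). *)

Set Implicit Arguments.
Unset Strict Implicit.
Unset Printing Implicit Defensive.

Import Order.TTheory GRing.Theory Num.Theory.
Import numFieldNormedType.Exports.

Local Open Scope classical_set_scope.
Local Open Scope ring_scope.

(** * Souslin sets in a product with a Polish space *)

Section metric.
Context {R : realType} {P : completePseudoMetricType R}.
Implicit Types (V : set P) (p : nat -> P).

Lemma cauchy_ball_lim p :
  (forall e : R, 0 < e -> exists N, forall n m, (N <= n)%N -> (N <= m)%N ->
    ball (p n) e (p m)) ->
  exists y, forall e : R, 0 < e -> exists N, forall n, (N <= n)%N ->
    ball y e (p n).
Proof.
move=> pC; have : cauchy_ex (p @ \oo).
  move=> e e0; have [N Np] := pC e e0; exists (p N).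
  by exists N => //= n /= Nn; exact: Np.
move=> /cauchy_exP /cauchy_cvg /cvg_ballP pl.
exists (lim (p @ \oo)) => e e0; have [N _ Np] := pl e e0.
by exists N => n Nn; exact: Np.
Qed.

Lemma closed_approx V y :
  closed V -> (forall e : R, 0 < e -> exists2 z, V z & ball y e z) -> V y.
Proof.
move=> cV yV; apply: cV => B /nbhs_ballP[e /= e0 eB].
by have [z Vz yz] := yV e e0; exists z; split => //; exact: eB.
Qed.

Lemma hausdorff_ball_eq (x y : P) :
  hausdorff_space P -> (forall e : R, 0 < e -> ball x e y) -> x = y.
Proof.
move=> hP xy; apply: hP => A B /nbhs_ballP[e /= e0 eA] /nbhs_ballP[f /= f0 fB].
by exists y; split; [exact/eA/xy|exact/fB/ballxx].
Qed.

(** The points whose ball of radius [1/(n+1)] lies in [O] need not form a closed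
    set, but their closure is still contained in [O]. *)
Lemma open_bigcup_closed (O : set P) : open O ->
  exists2 F : nat -> set P, (forall n, closed (F n)) & O = \bigcup_n F n.
Proof.
move=> oO; exists (fun n => closure [set y | ball y n.+1%:R^-1 `<=` O]).
  by move=> n; exact: closed_closure.
apply/seteqP; split=> [y Oy|y [n _ yO]].
  have /nbhs_ballP[e /= e0 eO] : nbhs y O by exact: open_nbhs_nbhs.
  have [n ne] : exists n, (n.+1%:R^-1 < e)%R.
    have [n _ nP] := near_infty_natSinv_lt (PosNum e0).
    by exists n; exact: (nP n (leqnn n)).
  exists n => //; apply: subset_closure => z yz; apply: eO.
  exact: (le_ball (ltW ne)).
have n0 : 0 < n.+1%:R^-1 :> R by rewrite invr_gt0.
have [z [zO yz]] := yO _ (nbhsx_ballx y _ n0).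
exact/zO/ball_sym.
Qed.

End metric.

Definition agree (k : nat) (a b : nat -> nat) :=
  forall i, (i < k)%N -> a i = b i.

Section souslin.
Context {R : realType} {d : measure_display} {X : measurableType d}
  {P : completePseudoMetricType R}.
Implicit Types (A : set (X * P)).

(** A Souslin operation on rectangles with measurable first and closed second
    side. The [n]-th rectangle may depend on any finite part of the branch [a]
    instead of on its first [n] terms; this freedom makes countable unions and
    intersections a matter of recoding branches. *)
Definition souslin A := exists (B : nat -> (nat -> nat) -> set X)
    (V : nat -> (nat -> nat) -> set P),
  [/\ forall n a, measurable (B n a), forall n a, closed (V n a),
      forall n a, exists k, forall b, agree k a b ->
        B n a = B n b /\ V n a = V n b
    & A = [set z | exists a, forall n, B n a z.1 /\ V n a z.2]].

Lemma souslin_rect (B : set X) (V : set P) :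
  measurable B -> closed V -> souslin (B `*` V).
Proof.
move=> mB cV; exists (fun _ _ => B), (fun _ _ => V); split => //.
  by move=> n a; exists 0%N.
apply/seteqP; split=> [[x y] [/= Bx Vy]|[x y] /= [a /(_ 0%N)//]].
by exists id.
Qed.

Lemma souslin_bigcup (A : nat -> set (X * P)) :
  (forall m, souslin (A m)) -> souslin (\bigcup_m A m).
Proof.
move=> /choice[B] /choice[V] BV.
(* The first term of a branch chooses a set of the family. *)
pose sh (a : nat -> nat) := fun i => a i.+1.
exists (fun n a => B (a 0%N) n (sh a)), (fun n a => V (a 0%N) n (sh a)); split.
- by move=> n a; case: (BV (a 0%N)).
- by move=> n a; case: (BV (a 0%N)).
- move=> n a; have [_ _ /(_ n (sh a))[k kP] _] := BV (a 0%N).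
  exists k.+1 => b ab; rewrite -(ab 0%N)//.
  by apply: kP => i ik; exact: ab.
- apply/seteqP; split=> [z [m _]|z [a az]].
    have [_ _ _ AE] := BV m; rewrite AE => /= -[c cz].
    by exists (fun i => if i is j.+1 then c j else m) => n; exact: cz.
  by exists (a 0%N) => //; have [_ _ _ AE] := BV (a 0%N); rewrite AE; exists (sh a).
Qed.

Lemma souslin_bigcap (A : nat -> set (X * P)) :
  (forall m, souslin (A m)) -> souslin (\bigcap_m A m).
Proof.
move=> /choice[B] /choice[V] BV.
(* A single branch codes one branch for each set of the family. *)
pose proj (m : nat) (a : nat -> nat) := fun i : nat => a (pickle (m, i)).
pose C (n : nat) (a : nat -> nat) : set X :=
  if @unpickle (nat * nat)%type n is Some (m, n') then
  B m n' (proj m a) else setT.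
pose W (n : nat) (a : nat -> nat) : set P :=
  if @unpickle (nat * nat)%type n is Some (m, n') then
  V m n' (proj m a) else setT.
exists C, W; split.
- move=> n a; rewrite /C; case: unpickle => [[m n']|]; last exact: measurableT.
  by case: (BV m).
- move=> n a; rewrite /W; case: unpickle => [[m n']|]; last exact: closedT.
  by case: (BV m).
- move=> n a; rewrite /C /W; case: unpickle => [[m n']|]; last by exists 0%N.
  have [_ _ /(_ n' (proj m a))[k kP] _] := BV m.
  exists (\max_(i < k) (pickle (m, (i : nat))).+1)%N => b ab.
  apply: kP => i ik; apply: ab.
  exact: (@leq_bigmax _ (fun i : 'I_k => (pickle (m, (i : nat))).+1) (Ordinal ik)).
- apply/seteqP; split=> [z Az|z [a az] m _].
    have /choice[a aP] m : exists a, forall n, B m n a z.1 /\ V m n a z.2.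
      by have [_ _ _ AE] := BV m; have := Az m I; rewrite AE.
    exists (fun j =>
      if @unpickle (nat * nat)%type j is Some (m, i) then a m i else 0%N).
    move=> n; rewrite /C /W; case: unpickle => [[m n']|//].
    rewrite (_ : proj _ _ = a m)//; apply/funext => i.
    by rewrite /proj pickleK.
  have [_ _ _ AE] := BV m; rewrite AE; exists (proj m a) => n.
  by have := az (pickle (m, n)); rewrite /C /W pickleK.
Qed.

Let bisouslin := [set A | souslin A /\ souslin (~` A)].

Lemma bisouslin_sigma_algebra : sigma_algebra setT bisouslin.
Proof.
split.
- split.
    have -> : set0 = setT `*` set0 :> set (X * P) by rewrite setX0.
    by apply: souslin_rect => //; exact: closed0.
  rewrite setC0; have -> : setT = setT `*` setT :> set (X * P) by rewrite setXTT.
  by apply: souslin_rect => //; exact: closedT.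
- by move=> A [sA sC]; rewrite setTD; split => //; rewrite setCK.
- move=> A sA; split; first by apply: souslin_bigcup => m; case: (sA m).
  by rewrite setC_bigcup; apply: souslin_bigcap => m; case: (sA m).
Qed.

(** The complement of a strip over a measurable set is a strip, and the complement
    of a closed strip is a countable union of closed strips; an induction over the
    Borel sets starts from these two cases. *)
Lemma souslin_prod (B : set X) (C : set P) :
  measurable B -> <<s @open P >> C -> bisouslin (B `*` C).
Proof.
move=> mB sC; have [s0 sD sU] := bisouslin_sigma_algebra.
have sCm A : bisouslin A -> bisouslin (~` A) by rewrite -setTD; exact: sD.
have sI A A' : bisouslin A -> bisouslin A' -> bisouslin (A `&` A').
  move=> sA sA'; rewrite -[_ `&` _]setCK setCI; apply: (sCm).
  rewrite -bigcup2E; apply: sU => -[|[|n]] /=; [exact: sCm|exact: sCm|exact: s0].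
have -> : B `*` C = (B `*` setT) `&` (setT `*` C).
  by apply/seteqP; split=> [[x y] [/= ? ?]|[x y] [[/= ? ?] [/= ? ?]]].
apply: sI.
  split; first by apply: souslin_rect => //; exact: closedT.
  rewrite (_ : ~` _ = (~` B) `*` setT); last first.
    apply/seteqP; split=> [[x y] /= nB|[x y] [/= nB _] []//].
    by split => // Bx; apply: nB.
  by apply: souslin_rect; [exact: measurableC|exact: closedT].
suff : <<s @open P >> `<=` [set C | bisouslin (setT `*` C)] by apply.
apply: smallest_sub; last first.
  move=> O oO; change (bisouslin (setT `*` O)).
  rewrite -[_ `*` _]setCK; apply: (sCm).
  split; last first.
    rewrite setCK; have [F cF ->] := open_bigcup_closed oO.
    rewrite (_ : _ `*` _ = \bigcup_n (setT `*` F n)); last first.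
      apply/seteqP; split=> [[x y] [_ [n _ Fy]]|[x y] [n _ [_ Fy]]]; first by exists n.
      by split => //; exists n.
    by apply: souslin_bigcup => n; apply: souslin_rect.
  rewrite (_ : ~` _ = setT `*` (~` O)); last first.
    apply/seteqP; split=> [[x y] /= nO|[x y] [/= _ nO] []//].
    by split => // Oy; apply: nO.
  by apply: souslin_rect => //; exact: open_closedC.
split.
- by rewrite /= setX0; exact: s0.
- move=> A /= sA; rewrite setTD (_ : _ `*` _ = ~` (setT `*` A)); first exact: sCm.
  apply/seteqP; split=> [[x y] [_ nA] []//|[x y] /= nA].
  by split => // Ay; apply: nA.
- move=> A sA /=; rewrite (_ : _ `*` _ = \bigcup_n (setT `*` A n)); first exact: sU.
  apply/seteqP; split=> [[x y] [_ [n _ Fy]]|[x y] [n _ [_ Fy]]]; first by exists n.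
  by split => //; exists n.
Qed.

End souslin.

Section scheme.
Context {R : realType} {d : measure_display} {X : measurableType d}
  {P : completePseudoMetricType R}.
Local Notation I := (nat * nat)%type.

Lemma dense_seq : polish_space P ->
  exists e : nat -> P, forall y (r : R), 0 < r -> exists i, ball (e i) r y.
Proof.
move=> [_ [D /countable_injP[f finj] dD]].
exists (fun n => xget point [set y | D y /\ f y = n]) => y r r0.
have /(dD (ball y r)°) : (ball y r)° !=set0.
  by exists y; exact: nbhsx_ballx.
move=> /(_ (open_interior _))[z [/interior_subset yz Dz]].
exists (f z); case: xgetP => [w _ [Dw fwz]|/(_ z)[]//].
by rewrite (finj _ _ (mem_set Dw) (mem_set Dz) fwz); exact: ball_sym.
Qed.

Lemma closure_ball2 (c y : P) (r : R) : 0 < r -> closure (ball c r) y ->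
  ball c (r + r) y.
Proof.
move=> r0 /(_ _ (nbhsx_ballx y r r0))[w [cw yw]].
exact/(ball_triangle cw)/ball_sym.
Qed.

(** Listing the finite stages of a Souslin operation along the tree of finite
    sequences; the second entries name balls of a dense sequence, which force
    the closed sets to shrink along every branch. *)
Lemma souslin_scheme (A : set (X * P)) : polish_space P -> souslin A ->
  exists (B : seq I -> set X) (V : seq I -> set P),
  [/\ forall t, measurable (B t) /\ closed (V t),
      forall e : R, 0 < e -> exists N, forall t, (N <= size t)%N ->
        forall y z, V t y -> V t z -> ball y e z,
      forall t s, B (t ++ s) `<=` B t /\ V (t ++ s) `<=` V t &
      A = [set z | exists g, forall n, B (mkseq g n) z.1 /\ V (mkseq g n) z.2]].
Proof.
move=> /dense_seq[e eP] [B [V [mB cV lBV AE]]].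
pose ext (t : seq I) := fun i => (nth (0%N, 0%N) t i).1.
(* The [n]-th rectangle is already determined by the finite sequence [t]. *)
pose dec n t := forall b, agree (size t) (ext t) b ->
  B n (ext t) = B n b /\ V n (ext t) = V n b.
pose D t := \bigcap_(i in [set i | (i < size t)%N])
  closure (ball (e (nth (0%N, 0%N) t i).2) (i.+1%:R^-1 : R)).
have decS n t s : dec n t ->
    [/\ dec n (t ++ s), B n (ext (t ++ s)) = B n (ext t) &
        V n (ext (t ++ s)) = V n (ext t)].
  have ag : agree (size t) (ext t) (ext (t ++ s)).
    by move=> i it; rewrite /ext nth_cat it.
  move=> dt; have [<- <-] := dt _ ag; split=> // b; rewrite size_cat => bs.
  have [<- <-] := dt _ ag; apply: dt => i it.
  by rewrite ag// bs// ltn_addr.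
have ext_mkseq g n : agree n (ext (mkseq g n)) (fun i => (g i).1).
  by move=> i ni; rewrite /ext nth_mkseq.
exists (fun t => \bigcap_(n in [set n | dec n t]) B n (ext t)),
  (fun t => \bigcap_(n in [set n | dec n t]) V n (ext t) `&` D t); split.
- move=> t; split; first by apply: bigcap_measurableType => // n _; exact: mB.
  apply: closedI; first by apply: closed_bigI => n _; exact: cV.
  by apply: closed_bigI => n _; exact: closed_closure.
- move=> r r0; have r40 : 0 < r / 4 by rewrite divr_gt0.
  have [k _ kP] := near_infty_natSinv_lt (PosNum r40).
  exists k.+1 => t kt y z [_ /(_ k kt) yk] [_ /(_ k kt) zk].
  have k0 : 0 < k.+1%:R^-1 :> R by rewrite invr_gt0.
  have /= kr := kP k (leqnn k).
  have /ball_sym/ball_triangle := closure_ball2 k0 yk.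
  move=> /(_ _ _ (closure_ball2 k0 zk)); apply: le_ball.
  by move: kr; set q := _^-1 => kr; lra.
- move=> t s; split=> [x Bx n dn|y [Vy Dy]].
    by have [ds <- _] := decS _ _ s dn; exact: Bx.
  split=> [n dn|i /= it]; first by have [ds _ <-] := decS _ _ s dn; exact: Vy.
  by have := Dy i; rewrite /= nth_cat it size_cat; apply; rewrite ltn_addr.
- rewrite AE; apply/seteqP; split=> [[x y] [a ax]|[x y] [g gx]].
    have /choice[c cP] i : exists j, ball (e j) (i.+1%:R^-1 : R) y.
      by apply: eP; rewrite invr_gt0.
    exists (fun i => (a i, c i)) => n.
    set t := mkseq _ n; have st : size t = n by rewrite size_mkseq.
    have ta : agree (size t) (ext t) a by rewrite st; exact: ext_mkseq.
    split=> /= [m /= /(_ _ ta)[-> _]|]; first by case: (ax m).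
    split=> [m /= /(_ _ ta)[_ ->]|i]; first by case: (ax m).
    rewrite /= st => ni; rewrite /t nth_mkseq//.
    exact/subset_closure/cP.
  exists (fun i => (g i).1) => n /=.
  have [k kP] := lBV n (fun i => (g i).1).
  have [/= Bk [Vk _]] := gx k; have := Bk n; have := Vk n => /=.
  have dk : dec n (mkseq g k).
    move=> b; rewrite size_mkseq => kb.
    have [<- <-] : B n (fun i => (g i).1) = B n (ext (mkseq g k)) /\
                   V n (fun i => (g i).1) = V n (ext (mkseq g k)).
      by apply: kP => i ik; rewrite ext_mkseq.
    by apply: kP => i ik; rewrite -kb// ext_mkseq.
  have [<- <-] := kP (ext (mkseq g k)) (fun i ik => esym (ext_mkseq g k i ik)).
  by move=> /(_ dk) ? /(_ dk).
Qed.

End scheme.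

(** * Measurable predicates and exhaustion *)

Section measurable_predicates.
Context {d : measure_display} {X : measurableType d}.
Implicit Types (A B : X -> Prop).

Lemma measurable_exists (I : countType) (F : I -> X -> Prop) :
  (forall i, measurable [set x | F i x]) -> measurable [set x | exists i, F i x].
Proof.
move=> mF; rewrite (_ : mkset _ = \bigcup_i [set x | F i x]).
  by apply: countable_bigcupT_measurable; [exact: countableP|exact: mF].
by apply/seteqP; split=> [x [i ?]|x [i _ ?]]; exists i.
Qed.

Lemma measurable_not A : measurable [set x | A x] -> measurable [set x | ~ A x].
Proof. exact: measurableC. Qed.

Lemma measurable_forall (I : countType) (F : I -> X -> Prop) :
  (forall i, measurable [set x | F i x]) -> measurable [set x | forall i, F i x].
Proof.
move=> mF; rewrite (_ : mkset _ = ~` [set x | exists i, ~ F i x]).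
  by apply/measurableC/measurable_exists => i; exact: measurable_not.
by apply/seteqP; split=> [x Fx [i]|x /forallNP Fx i]; [exact|exact: contrapT (Fx i)].
Qed.

Lemma measurable_and A B : measurable [set x | A x] -> measurable [set x | B x] ->
  measurable [set x | A x /\ B x].
Proof. exact: measurableI. Qed.

Lemma measurable_or A B : measurable [set x | A x] -> measurable [set x | B x] ->
  measurable [set x | A x \/ B x].
Proof. exact: measurableU. Qed.

Lemma measurable_prop (p : Prop) : measurable [set _ : X | p].
Proof.
have [hp|hp] := pselect p.
  by rewrite (_ : mkset _ = setT)//; apply/seteqP; split.
by rewrite (_ : mkset _ = set0)//; apply/seteqP; split.
Qed.

Lemma measurable_imply A B : measurable [set x | A x] -> measurable [set x | B x] ->
  measurable [set x | A x -> B x].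
Proof.
move=> mA mB; rewrite (_ : mkset _ = [set x | ~ A x \/ B x]).
  by apply: measurable_or => //; exact: measurable_not.
apply/seteqP; split=> [x AB|x [nA|Bx] Ax] //=.
by have [/AB|] := pselect (A x); [right|left].
Qed.

End measurable_predicates.

Section exhaustion.
Context {R : realType} {d : measure_display} {X : measurableType d}.
Context (mu : probability X R).

(** A countable union of sets whose measures approach the supremum of the
    measures of the sets in the family absorbs every other set of the family. *)
Lemma exhaustion (F : set (set X)) : F set0 ->
  (forall W : nat -> set X, (forall n, measurable (W n) /\ F (W n)) ->
    F (\bigcup_n W n)) ->
  exists S, [/\ measurable S, F S &
    forall W, measurable W -> F W -> mu (W `\` S) = 0%E].
Proof.
move=> F0 FU; pose M := [set mu W | W in [set W | measurable W /\ F W]].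
have M1 W : measurable W -> (mu W <= 1)%E by exact: probability_le1.
have sfin : ereal_sup M \is a fin_num.
  rewrite fin_numElt; apply/andP; split.
    apply: (@lt_le_trans _ _ 0%E); first exact: ltNy0.
    by apply: ereal_sup_ubound; exists set0; rewrite ?measure0.
  apply: (@le_lt_trans _ _ 1%E); last exact: ltry.
  by apply: ge_ereal_sup => _ [W [mW _] <-]; exact: M1.
have /choice[W WP] n : exists W, [/\ measurable W, F W &
    (ereal_sup M - n.+1%:R^-1%:E < mu W)%E].
  have n0 : 0 < n.+1%:R^-1 :> R by rewrite invr_gt0.
  by have [_ [W [mW FW] <-] ltW] := ub_ereal_sup_adherent n0 sfin; exists W.
pose S := \bigcup_n W n.
have mS : measurable S by apply: bigcup_measurable => n _; case: (WP n).
have sS : (ereal_sup M <= mu S)%E.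
  apply/lee_addgt0Pr => e e0.
  have [n _ nP] := near_infty_natSinv_lt (PosNum e0).
  have [mW _ ltW] := WP n.
  have le1 : (mu (W n) <= mu S)%E.
    by apply: le_measure; rewrite ?inE//; exact: bigcup_sup.
  have /= := nP n (leqnn n); rewrite -lte_fin => ne.
  move: ltW; rewrite lteBlDr// => /ltW/le_trans; apply.
  by apply: leeD => //; exact: ltW.
have FS : F S by apply: (FU) => n; case: (WP n).
exists S; split => // U mU FU'.
have mD : measurable (U `\` S) by exact: measurableD.
have mUS : measurable (S `|` (U `\` S)) by exact: measurableU.
have : (mu (S `|` (U `\` S)) <= mu S)%E.
  apply: (le_trans _ sS); apply: ereal_sup_ubound.
  exists (S `|` (U `\` S)) => //; split => //.
  have -> : S `|` (U `\` S) = S `|` U.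
    apply/seteqP; split=> [x [|[]]|x [|Ux]]; [by left|by right|by left|].
    by have [Sx|nSx] := pselect (S x); [left|right].
  rewrite -bigcup2E; apply: (FU) => -[|[|n]] //=.
have S0 : mu S \is a fin_num by rewrite fin_num_measure.
rewrite measureU//; last by rewrite setDE setIC -setIA setICl setI0.
by rewrite -[leRHS]adde0 leeD2lE// => ?; apply/eqP; rewrite eq_le measure_ge0 andbT.
Qed.

End exhaustion.

(** * The Lusin--Novikov theorem modulo a null set *)

Section branches.
Context {R : realType} {P : completePseudoMetricType R} {X : Type}.
Local Notation I := (nat * nat)%type.
Context (B : seq I -> set X) (V : seq I -> set P).
Context (cV : forall t, closed (V t)).
Context (diamV : forall e : R, 0 < e -> exists N, forall t, (N <= size t)%N ->
  forall y z, V t y -> V t z -> ball y e z).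
Context (mono : forall t s, B (t ++ s) `<=` B t /\ V (t ++ s) `<=` V t).

(** Diagonalisation: if nodes of a set [Q] of the tree always have two
    extensions in [Q] with disjoint closed sets, then a branch can avoid at its
    [n]-th step the [n]-th point of any given sequence. *)
Lemma branch_escape (Q : set (seq I)) (x : X) (e : nat -> P) :
  (forall t, Q t -> B t x /\ V t !=set0) ->
  (forall t, Q t -> exists u u', [/\ V (t ++ u) `&` V (t ++ u') = set0,
    Q (t ++ u) & Q (t ++ u')]) ->
  Q [::] ->
  exists2 y, exists g, forall n, B (mkseq g n) x /\ V (mkseq g n) y &
    forall n, e n <> y.
Proof.
move=> QBV Qsplit Q0.
have step (tn : seq I * nat) : exists u, Q tn.1 ->
    [/\ Q (tn.1 ++ u), ~ V (tn.1 ++ u) (e tn.2) & (0 < size u)%N].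
  case: tn => t n /=; have [Qt|nQt] := pselect (Q t); last by exists [::].
  have [u [u' [uu' Qu Qu']]] := Qsplit t Qt.
  have pos v v' : V (t ++ v) `&` V (t ++ v') = set0 -> Q (t ++ v') ->
      (0 < size v)%N.
    case: v => //; rewrite cats0 => vv' /QBV[_ [y v'y]].
    have : (V t `&` V (t ++ v')) y by split => //; exact: (mono t v').2.
    by rewrite vv'.
  have [Vu|nVu] := pselect (V (t ++ u) (e n)).
    exists u' => _; split => //; last by apply: (pos _ u) => //; rewrite setIC.
    move=> Vu'; have : (V (t ++ u) `&` V (t ++ u')) (e n) by split.
    by rewrite uu'.
  by exists u => _; split => //; exact: (pos _ u').
have [f fP] := choice step.
pose T := fix T n := if n is m.+1 then T m ++ f (T m, m) else [::].
have QT n : Q (T n) by elim: n => //= n Qn; case: (fP (T n, n) Qn).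
have TS n : exists s, T n.+1 = T n ++ s by exists (f (T n, n)).
have Tadd k n : exists s, T (k + n)%N = T k ++ s.
  elim: n => [|n [s Ts]]; first by exists [::]; rewrite addn0 cats0.
  have [s' Ts'] := TS (k + n)%N.
  by exists (s ++ s'); rewrite addnS Ts' Ts catA.
have Tle k n : (k <= n)%N -> exists s, T n = T k ++ s.
  by move=> /subnKC <-; exact: Tadd.
have sT n : (n <= size (T n))%N.
  elim: n => //= n nT; have [_ _ /= ] := fP (T n, n) (QT n).
  by rewrite size_cat => /(leq_add nT); rewrite addn1.
have /choice[z zP] n : exists z, V (T n) z by have [_] := QBV _ (QT n).
have zT k n : (k <= n)%N -> V (T k) (z n).
  move=> /Tle[s Ts]; apply: (mono (T k) s).2.
  by rewrite -Ts; exact: zP.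
have [r r0|y yP] := @cauchy_ball_lim _ _ z.
  have [N NP] := diamV r0; exists N => n m Nn Nm.
  by apply: (NP (T N)) => //; exact: zT.
have VTy n : V (T n) y.
  apply: (closed_approx (@cV _)) => r /yP[N NP].
  by exists (z (maxn N n)); [apply: zT; exact: leq_maxr|apply: NP; exact: leq_maxl].
pose g i := nth (0%N, 0%N) (T i.+1) i.
have Tg n : exists s, T n = mkseq g n ++ s.
  exists (drop n (T n)); rewrite -[LHS](cat_take_drop n); congr (_ ++ _).
  apply: (@eq_from_nth _ (0%N, 0%N)); rewrite size_takel ?size_mkseq// => i ilt.
  rewrite nth_take// nth_mkseq// /g; have [s ->] := Tle _ _ ilt.
  by rewrite nth_cat sT.
exists y.
  exists g => n; have [s Ts] := Tg n; have [Bm Vm] := mono (mkseq g n) s.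
  split; first by apply: Bm; rewrite -Ts; case: (QBV _ (QT n)).
  by apply: Vm; rewrite -Ts.
move=> n eny; have [_ /= nV _] := fP (T n, n) (QT n); apply: nV.
by rewrite eny; exact: (VTy n.+1).
Qed.

End branches.

Section lusin_novikov.
Context {R : realType} {d : measure_display} {X : measurableType d}
  {P : completePseudoMetricType R}.
Local Notation I := (nat * nat)%type.

(** Closed sets suffice to test Borel measurability of a map into [P]. *)
Definition Borel_map (g : X -> P) :=
  forall C, closed C -> measurable (g @^-1` C).

(** The part of [A] over [W] is contained in a countable union of graphs. The set
    [A] is arbitrary: this notion of smallness is applied to the Souslin sets
    attached to the nodes of a scheme, which need not be measurable. *)
Definition graph_covered (A : set (X * P)) (W : set X) :=
  exists2 g : nat -> X -> P, forall n, Borel_map (g n) &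
    forall x y, A (x, y) -> W x -> exists n, g n x = y.

Lemma Borel_map_cst (y : P) : Borel_map (fun=> y).
Proof. by move=> C _; exact: measurable_prop. Qed.

Lemma graph_covered_countType (J : countType) (g : J -> X -> P) A W :
  (forall j, Borel_map (g j)) ->
  (forall x y, A (x, y) -> W x -> exists j, g j x = y) -> graph_covered A W.
Proof.
move=> mg gA; exists (fun n => if unpickle n is Some j then g j else fun=> point).
  by move=> n; case: unpickle => [j|]; [exact: mg|exact: Borel_map_cst].
by move=> x y /gA/[apply] -[j <-]; exists (pickle j); rewrite pickleK.
Qed.

Lemma graph_covered0 A : graph_covered A set0.
Proof. by exists (fun _ _ => point) => // n; exact: Borel_map_cst. Qed.

Lemma graph_covered_bigcup A (W : nat -> set X) :
  (forall n, graph_covered A (W n)) -> graph_covered A (\bigcup_n W n).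
Proof.
move=> AW; have /choice[g gP] n : exists g : nat -> X -> P,
    (forall m, Borel_map (g m)) /\
    forall x y, A (x, y) -> W n x -> exists m, g m x = y.
  by have [g] := AW n; exists g.
apply: (@graph_covered_countType (nat * nat)%type (fun j => g j.1 j.2)).
  by move=> j; case: (gP j.1).
move=> x y Axy [n _ Wx]; have [_ /(_ x y Axy Wx)[m <-]] := gP n.
by exists (n, m).
Qed.

Section scheme_cover.
Context (B : seq I -> set X) (V : seq I -> set P).
Context (hP : hausdorff_space P).
Context (diamV : forall e : R, 0 < e -> exists N, forall t, (N <= size t)%N ->
  forall y z, V t y -> V t z -> ball y e z).

Definition stem_part (t : seq I) : set (X * P) := [set z | exists g,
  mkseq g (size t) = t /\
  forall n, B (mkseq g n) z.1 /\ V (mkseq g n) z.2].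

Context (S : seq I -> set X).
Context (mS : forall t, measurable (S t)).
Context (coveredS : forall t, graph_covered (stem_part t) (S t)).

(** A node [u] survives at [x] if [S u] does not contain [x]. Where no two
    surviving nodes above [t] have disjoint closed sets, surviving nodes have at
    most one limit point. *)
Definition unsplit (t : seq I) : set X := [set x | forall uu : seq I * seq I,
  V (t ++ uu.1) `&` V (t ++ uu.2) = set0 -> S (t ++ uu.1) x \/ S (t ++ uu.2) x].

Let limit_at t x y := forall e : R, 0 < e -> exists N, forall u,
  (N <= size u)%N -> ~ S (t ++ u) x -> forall z, V (t ++ u) z -> ball y e z.

(** The points at which the surviving nodes above [t] determine a limit. *)
Let deep t (x : X) := unsplit t x /\
  forall N : nat, exists u, ((N <= size u)%N /\ V (t ++ u) !=set0) /\ ~ S (t ++ u) x.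

Let unsplit_meet t x u u' : unsplit t x -> ~ S (t ++ u) x -> ~ S (t ++ u') x ->
  V (t ++ u) `&` V (t ++ u') !=set0.
Proof.
move=> ut nu nu'; apply/set0P/eqP => uu'.
by case: (ut (u, u') uu').
Qed.

Let unsplit_near t x : unsplit t x -> forall e : R, 0 < e -> exists N,
  forall u u', (N <= size u)%N -> (N <= size u')%N ->
    ~ S (t ++ u) x -> ~ S (t ++ u') x ->
    forall z z', V (t ++ u) z -> V (t ++ u') z' -> ball z e z'.
Proof.
move=> ut e e0; have e20 : 0 < e / 2 by rewrite divr_gt0.
have [N NP] := diamV e20; exists N => u u' Nu Nu' nu nu' z z' uz uz'.
have [w [uw u'w]] := unsplit_meet ut nu nu'.
apply: (@ball_split _ _ w).
  by apply: (NP (t ++ u)) => //; rewrite size_cat (leq_trans Nu)// leq_addl.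
by apply: (NP (t ++ u')) => //; rewrite size_cat (leq_trans Nu')// leq_addl.
Qed.

Let limit_ex t x : deep t x -> exists y, limit_at t x y.
Proof.
move=> [ut dt]; have [u uP] := choice dt.
have /choice[z zP] n : exists z, V (t ++ u n) z.
  by have [[_ [z uz]] _] := uP n; exists z.
have [e e0|y yP] := @cauchy_ball_lim _ _ z.
  have [N NP] := unsplit_near ut e0; exists N => n m Nn Nm.
  have [[un _] nun] := uP n; have [[um _] num] := uP m.
  by apply: (NP (u n) (u m)) => //; [exact: leq_trans un|exact: leq_trans um].
exists y => e e0; have e20 : 0 < e / 2 by rewrite divr_gt0.
have [N NP] := yP _ e20; have [M MP] := unsplit_near ut e20.
exists M => v Mv nv w vw; have [[un _] nun] := uP (maxn N M).
apply: (@ball_split _ _ (z (maxn N M))); first by apply: NP; exact: leq_maxl.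
apply: (MP (u (maxn N M)) v) => //.
by apply: leq_trans un; exact: leq_maxr.
Qed.

Let limit_unique t x y y' : deep t x -> limit_at t x y -> limit_at t x y' -> y = y'.
Proof.
move=> [ut dt] yl yl'; apply: hausdorff_ball_eq => // e e0.
have e20 : 0 < e / 2 by rewrite divr_gt0.
have [N NP] := yl _ e20; have [M MP] := yl' _ e20.
have [u [[uM [z uz]] nu]] := dt (maxn N M).
apply: (@ball_splitl _ _ z).
  by apply: (NP u) => //; apply: leq_trans uM; exact: leq_maxl.
by apply: (MP u) => //; apply: leq_trans uM; exact: leq_maxr.
Qed.

Let mdeep t : measurable (deep t).
Proof.
apply: measurable_and.
  apply: (@measurable_forall _ _ (seq I * seq I)%type) => uu; apply: measurable_imply.
    exact: measurable_prop.
  by apply: measurable_or; exact: mS.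
apply: measurable_forall => N; apply: (@measurable_exists _ _ (seq I)) => u.
by apply: measurable_and; [exact: measurable_prop|apply/measurable_not/mS].
Qed.

Let stem_limit t x : P :=
  if pselect (deep t x) then xget point (limit_at t x) else point.

Let stem_limitP t x : deep t x -> limit_at t x (stem_limit t x).
Proof.
move=> dx; rewrite /stem_limit; case: pselect => //= _.
by have [y yl] := limit_ex dx; exact: (xgetI _ yl).
Qed.

Let Borel_stem_limit t : Borel_map (stem_limit t).
Proof.
move=> C cC.
(* The limit lies in [C] iff arbitrarily long surviving nodes come close to [C];
   this needs no measurable choice of such nodes. *)
pose near_C (j : nat) x := exists u : seq I, ((j <= size u)%N /\
  exists2 z, V (t ++ u) z & exists2 c, C c & ball z (j.+1%:R^-1 : R) c) /\
  ~ S (t ++ u) x.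
rewrite (_ : _ @^-1` _ = [set x | (deep t x /\ forall j, near_C j x) \/
                                  (~ deep t x /\ C point)]).
  apply: measurable_or; apply: measurable_and.
  - exact: mdeep.
  - apply: measurable_forall => j; apply: (@measurable_exists _ _ (seq I)) => u.
    by apply: measurable_and; [exact: measurable_prop|apply/measurable_not/mS].
  - exact/measurable_not/mdeep.
  - exact: measurable_prop.
apply/seteqP; split=> x /=.
  have [dx Cl|ndx] := pselect (deep t x); last first.
    by rewrite /stem_limit; case: pselect => //= _ ?; right.
  left; split => // j; have j0 : 0 < j.+1%:R^-1 :> R by rewrite invr_gt0.
  have [N NP] := stem_limitP dx j0.
  have [_ /(_ (maxn N j))[u [[uM [z uz]] nu]]] := dx.
  exists u; split => //; split; first by apply: leq_trans uM; exact: leq_maxr.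
  exists z => //; exists (stem_limit t x) => //; apply: ball_sym.
  by apply: (NP u) => //; apply: leq_trans uM; exact: leq_maxl.
move=> [[dx nC]|[ndx Cp]]; last by rewrite /stem_limit; case: pselect => //=.
apply: (closed_approx cC) => e e0; have e20 : 0 < e / 2 by rewrite divr_gt0.
have [N NP] := stem_limitP dx e20.
have [k _ kP] := near_infty_natSinv_lt (PosNum e20).
have [u [[uM [z uz [c Cc zc]]] nu]] := nC (maxn N k).
exists c => //; apply: (@ball_split _ _ z).
  by apply: (NP u) => //; apply: leq_trans uM; exact: leq_maxl.
apply: le_ball zc; apply: ltW; exact: (kP _ (leq_maxr _ _)).
Qed.

(** Where no splitting occurs, the part of the Souslin set lying on surviving
    branches is the graph of one Borel map, and the rest lies over sets [S]. *)
Lemma graph_covered_unsplit t : graph_covered (stem_part t) (unsplit t).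
Proof.
have /choice[h hP'] u : exists h : nat -> X -> P, (forall m, Borel_map (h m)) /\
    forall x y, stem_part u (x, y) -> S u x -> exists m, h m x = y.
  by have [h] := coveredS u; exists h.
pose H (j : option (seq I * nat)) := if j is Some (u, n) then h u n else stem_limit t.
apply: (@graph_covered_countType _ H).
  case=> [[u n]|] /=; last exact: Borel_stem_limit.
  by have [mh _] := hP' u; exact: mh.
move=> x y [g [gt gxy]] ut.
have mkD n k : mkseq g (n + k) = mkseq g n ++ mkseq (fun i => g (n + i)%N) k.
  by rewrite /mkseq iotaD map_cat add0n -[in X in _ ++ X](addn0 n) iotaDl -map_comp.
have [[n Sn]|] := pselect (exists n, S (mkseq g n) x).
  have sxy : stem_part (mkseq g n) (x, y) by exists g; rewrite size_mkseq.
  have [_ /(_ x y sxy Sn)[m <-]] := hP' (mkseq g n).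
  by exists (Some (mkseq g n, m)).
move=> /forallNP nS; exists None => /=.
pose w k := mkseq (fun i => g (size t + i)%N) k.
have tw k : t ++ w k = mkseq g (size t + k) by rewrite mkD gt.
have dx : deep t x.
  split => // N; exists (w N); rewrite tw; split; last exact: nS.
  by split; [rewrite size_mkseq|exists y; case: (gxy (size t + N)%N)].
apply: (limit_unique dx (stem_limitP dx)) => e e0.
have [N NP] := unsplit_near ut e0; exists N => u Nu nu z uz.
apply: (NP (w N) u) => //; rewrite ?tw ?size_mkseq//.
by case: (gxy (size t + N)%N).
Qed.

End scheme_cover.

(** Lusin--Novikov modulo a null set. For each node [t] take a largest set over
    which the part of [A] through [t] is covered; if the set left over at the
    root had positive measure, then almost all of its points would see a
    splitting at every surviving node, and so have an uncountable section. *)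
Theorem lusin_novikov_ae (mu : probability X R) (A : set (X * P)) :
  polish_space P -> souslin A -> (forall x, countable [set y | A (x, y)]) ->
  exists2 N, measurable N /\ mu N = 0%E & graph_covered A (~` N).
Proof.
move=> pP sA cA; have hP : hausdorff_space P by case: pP.
have [B [V [mBV diamV mono AE]]] := souslin_scheme pP sA.
have /choice[S SP] t : exists S, [/\ measurable S,
    graph_covered (stem_part B V t) S &
    forall W, measurable W -> graph_covered (stem_part B V t) W ->
      mu (W `\` S) = 0%E].
  apply: exhaustion; first exact: graph_covered0.
  by move=> W mW; apply: graph_covered_bigcup => n; case: (mW n).
have mS t : measurable (S t) by case: (SP t).
have cS t : graph_covered (stem_part B V t) (S t) by case: (SP t).
have maxS t W : measurable W -> graph_covered (stem_part B V t) W ->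
    mu (W `\` S t) = 0%E by have [_ _ +] := SP t; apply.
(* The points surviving at [t] although the part of [A] through [t] is covered
   over them, because a side of the rectangle is missed or no splitting occurs. *)
pose M t := [set x | ~ (B t x /\ V t !=set0) \/ unsplit V S t x] `\` S t.
have munsplit t : measurable (unsplit V S t).
  apply: (@measurable_forall _ _ (seq I * seq I)%type) => uu; apply: measurable_imply.
    exact: measurable_prop.
  by apply: measurable_or; exact: mS.
have M0 t : mu (M t) = 0%E.
  apply: maxS.
    apply: measurable_or; last exact: munsplit.
    apply/measurable_not/measurable_and; last exact: measurable_prop.
    by case: (mBV t).
  have [h mh hP'] := graph_covered_unsplit hP diamV mS cS t.
  exists h => // x y xy; case=> [nBV|]; last exact: hP'.
  case: xy => g [gt /(_ (size t))]; rewrite gt => -[/= Bx Vy].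
  by exfalso; apply: nBV; split => //; exists y.
have mM t : measurable (M t).
  apply: measurableD => //; apply: measurable_or; last exact: munsplit.
  apply/measurable_not/measurable_and; last exact: measurable_prop.
  by case: (mBV t).
pose N := \bigcup_n (if @unpickle (seq I) n is Some t then M t else set0).
have mN : measurable N.
  by apply: bigcup_measurable => n _; case: unpickle.
have N0 : mu N = 0%E.
  apply/(negligibleP _ mN)/negligible_bigcup => n.
  by apply/(negligibleP _ (mM _)); exact: M0.
have NM x t : ~ N x -> ~ M t x.
  by move=> nN Mx; apply: nN; exists (pickle t) => //; rewrite pickleK.
exists N => //; have [h mh hP'] := cS [::]; exists h => // x y Axy nNx.
apply: hP'; first by move: Axy; rewrite AE => -[g gP]; exists g.
apply: contrapT => Q0.
have QP t : ~ S t x -> B t x /\ V t !=set0.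
  move=> nS; apply: contrapT => nBV; apply: (NM x t nNx); split => //.
  by left.
have Qsplit t : ~ S t x -> exists u u', [/\ V (t ++ u) `&` V (t ++ u') = set0,
    ~ S (t ++ u) x & ~ S (t ++ u') x].
  move=> nS; have nu : ~ unsplit V S t x.
    by move=> ut; apply: (NM x t nNx); split => //; right.
  apply: contrapT => H; apply: nu => -[u u'] /= uu'; apply: contrapT.
  by move=> /not_orP[nu nu']; apply: H; exists u, u'.
have /countable_injP[f finj] := cA x.
(* A sequence that exhausts the section of [A] over [x]. *)
pose e n := xget point [set y | A (x, y) /\ f y = n].
have [|||z xz nez] :=
  @branch_escape _ P X B V _ _ _ [set t | ~ S t x] x e QP Qsplit Q0.
- by move=> t; case: (mBV t).
- exact: diamV.
- exact: mono.
have Axz : A (x, z) by rewrite AE.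
apply: (nez (f z)); rewrite /e; case: xgetP => [w _ [Aw fwz]|/(_ z)[]//].
by apply: finj => //; rewrite inE.
Qed.

End lusin_novikov.

Section standard_borel.
Context {R : realType} {d : measure_display} {X : measurableType d}.

Lemma standard_borel_separated : standard_borel R X ->
  exists2 U : nat -> set X, forall n, measurable (U n) &
    forall x y, (forall n, U n x <-> U n y) -> x = y.
Proof.
move=> [P [f [pP bf mf]]]; have [hP _] := pP.
have [e eP] := dense_seq pP.
pose O (ij : nat * nat) := (ball (e ij.1) (ij.2.+1%:R^-1 : R))°.
have mO ij : measurable (f @^-1` O ij).
  apply/mf; rewrite (_ : f @` _ = O ij).
    by apply: sub_sigma_algebra; exact: open_interior.
  apply/seteqP; split=> [_ [x Ox <-]//|p Op]; have [g fg gf] := bf.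
  by exists (g p) => //=; rewrite gf.
exists (fun n =>
  if @unpickle (nat * nat)%type n is Some ij then f @^-1` O ij else set0).
  by move=> n; case: unpickle => [ij|]; [exact: mO|exact: measurable0].
move=> x y xy; have {}xy ij : O ij (f x) <-> O ij (f y).
  by have := xy (pickle ij); rewrite pickleK.
apply: (bij_inj bf); apply: hausdorff_ball_eq => // r r0.
have r20 : 0 < r / 2 by rewrite divr_gt0.
have [k _ kP] := near_infty_natSinv_lt (PosNum r20).
have /= kr := kP k (leqnn k).
have k0 : 0 < k.+1%:R^-1 / 2 :> R by rewrite divr_gt0// invr_gt0.
have [i ix] := eP (f x) _ k0.
have : O (i, k) (f x).
  apply/nbhs_ballP; exists (k.+1%:R^-1 / 2) => //= z xz.
  exact: (ball_split ix).
move=> /xy/interior_subset/= iy; apply: (@ball_splitr _ _ (e i)).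
  apply: le_ball ix; apply: (le_trans _ (ltW kr)).
  by rewrite ler_pdivrMr// ler_peMr ?invr_ge0 ?ler1n.
by apply: le_ball iy; exact: ltW.
Qed.

Lemma lusin_novikov_std (mu : probability X R) (A : set (X * X)) :
  standard_borel R X -> measurable A -> (forall x, countable [set y | A (x, y)]) ->
  exists (N : set X) (g : nat -> X -> X),
    [/\ measurable N, mu N = 0%E, forall n, measurable_fun setT (g n) &
        forall x y, A (x, y) -> ~ N x -> exists n, g n x = y].
Proof.
move=> [P [f [pP [h hf fh] mf]]] mA cA.
pose A' := [set z : X * P | A (z.1, h z.2)].
have imE C : f @` C = h @^-1` C.
  apply/seteqP; split=> [_ [x Cx <-]/=|p Cp]; first by rewrite hf.
  by exists (h p) => //; rewrite fh.
have sA : souslin A'.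
  have : measurable `<=` [set C : set (X * X) |
      let C' := [set z : X * P | C (z.1, h z.2)] in souslin C' /\ souslin (~` C')].
    rewrite measurable_prod_measurableType; apply: smallest_sub.
      have [s0 sD sU] := @bisouslin_sigma_algebra R d X P.
      split; first exact: s0.
        by move=> C sC; have := sD _ sC; rewrite !setTD.
      move=> C sC.
      have := sU (fun n => [set z | C n (z.1, h z.2)]) sC.
      by congr (souslin _ /\ souslin (~` _));
        apply/seteqP; split=> z [n _ ?]; exists n.
    move=> _ [B mB [C mC <-]] /=.
    have := souslin_prod (P := P) mB ((mf C).1 mC).
    by rewrite imE.
  by move=> /(_ _ mA)[].
have cA' x : countable [set p | A' (x, p)].
  rewrite (_ : [set p | _] = f @` [set y | A (x, y)]).
    exact: (sub_countable (card_image_le _ _)).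
  by rewrite imE.
have [N [mN N0] [g mg gA]] := lusin_novikov_ae mu pP sA cA'.
exists N, (fun n => h \o g n); split => //.
  move=> n _ C mC; rewrite setTI comp_preimage -(imE C).
  have : <<s @open P >> `<=` [set D | measurable (g n @^-1` D)].
    apply: smallest_sub; last first.
      move=> O oO /=; rewrite -(setCK O) preimage_setC; apply: measurableC.
      exact: (mg n _ (open_closedC oO)).
    split=> /=.
    - by rewrite preimage_set0; exact: measurable0.
    - by move=> D mD; rewrite setTD preimage_setC; exact: measurableC.
    - by move=> D mD; rewrite preimage_bigcup; exact: bigcup_measurable.
  by apply; exact/mf.
move=> x y Axy nNx; have A'xy : A' (x, f y) by rewrite /A' /= hf.
have [n gn] := gA x (f y) A'xy nNx.
by exists n; rewrite /= gn hf.
Qed.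

End standard_borel.

(** * Branches of forests *)

Section joined.
Context {X : Type} (T : set (X * X)).
Implicit Types (U W : set X) (v w x y z : X).

Lemma joined_refl U x : joined_in T U x x.
Proof. exact: rt_refl. Qed.

Lemma joined_trans U y x z : joined_in T U x y -> joined_in T U y z ->
  joined_in T U x z.
Proof. exact: rt_trans. Qed.

Lemma joined_step U x y : U x -> U y -> T (x, y) -> joined_in T U x y.
Proof. by move=> Ux Uy Txy; apply: rt_step. Qed.

Lemma joined_sub U W x y : U `<=` W -> joined_in T U x y -> joined_in T W x y.
Proof.
move=> UW; elim=> {x y} [x y [Ux Uy Txy]|x|x y z _ xy _ yz].
- by apply: joined_step => //; exact: UW.
- exact: joined_refl.
- exact: joined_trans yz.
Qed.

Lemma joined_setT U x y : joined_in T U x y -> connectedness T (x, y).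
Proof. exact: joined_sub. Qed.

Lemma connectedness_edge x y : T (x, y) -> connectedness T (x, y).
Proof. by move=> Txy; apply: (@joined_step setT). Qed.

Lemma joined_mem U x y : joined_in T U x y -> x = y \/ U x /\ U y.
Proof.
elim=> {x y} [x y [Ux Uy _]|x|x y z _ [->//|[Ux Uy]] _ [<-|[_ Uz]]].
- by right.
- by left.
- by right.
- by right.
Qed.

Lemma joined_walk_ind U y (Q : X -> Prop) : Q y ->
  (forall x z, U x -> U z -> T (x, z) -> joined_in T U z y -> Q z -> Q x) ->
  forall x, joined_in T U x y -> Q x.
Proof.
move=> Qy Qstep x xy; have {xy} := clos_rt_rt1n _ _ _ _ xy => xy.
move: Qy Qstep; elim: xy => {x y} [//|x z y [Ux Uz Txz] zy IH Qy Qstep].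
apply: (Qstep x z) => //; last exact: IH.
exact: clos_rt1n_rt.
Qed.

Lemma joined_sym U x y : (forall x y, T (x, y) -> T (y, x)) ->
  joined_in T U x y -> joined_in T U y x.
Proof.
move=> sT; elim=> {x y} [x y [Ux Uy /sT Tyx]|x|x y z _ yx _ zy].
- exact: joined_step.
- exact: joined_refl.
- exact: joined_trans zy yx.
Qed.

End joined.

(** For [y <> v] in the component of [v], this is the component containing [y]
    of the graph minus [v]. *)
Definition branch {X : Type} (T : set (X * X)) (v y : X) : set X :=
  [set z | joined_in T (~` [set v]) y z].

Section branches_of_graph.
Context {X : Type} (T : set (X * X)).
Context (gT : is_graph T).
Implicit Types (U W : set X) (v w x y z : X).

Let sT x y : T (x, y) -> T (y, x). Proof. by case: gT => _; apply. Qed.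
Let irT x : ~ T (x, x). Proof. by case: gT => + _; apply. Qed.

Lemma connectedness_refl x : connectedness T (x, x).
Proof. exact: joined_refl. Qed.

Lemma connectedness_sym x y : connectedness T (x, y) -> connectedness T (y, x).
Proof. exact: joined_sym. Qed.

Lemma connectedness_trans y x z : connectedness T (x, y) ->
  connectedness T (y, z) -> connectedness T (x, z).
Proof. exact: joined_trans. Qed.

Lemma branch_refl v y : branch T v y y. Proof. exact: joined_refl. Qed.

Lemma branch_sym v y z : branch T v y z -> branch T v z y.
Proof. exact: joined_sym. Qed.

Lemma branch_trans v y x z : branch T v x y -> branch T v y z -> branch T v x z.
Proof. exact: joined_trans. Qed.

Lemma branch_connected v y z : branch T v y z -> connectedness T (y, z).
Proof. exact: joined_setT. Qed.

Lemma branch_notin v y : y <> v -> ~ branch T v y v.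
Proof. by move=> yv vy; have [//|[_ nv]] := joined_mem vy; exact: nv. Qed.

Lemma branch_eq v y z : branch T v y z -> branch T v y = branch T v z.
Proof.
move=> yz; apply/seteqP; split=> w; last exact: branch_trans yz.
exact/branch_trans/branch_sym.
Qed.

(** A walk from [y] to [v] meets [v] first or [v'] first. *)
Lemma branch_cover v v' y : v <> v' -> connectedness T (v, y) ->
  branch T v' v y \/ branch T v v' y.
Proof.
move=> vv' /connectedness_sym yv.
suff : branch T v' y v \/ branch T v y v' by case=> /branch_sym; [left|right].
move: y yv; apply: joined_walk_ind; first by left; exact: branch_refl.
move=> x z _ _ Txz _ IH.
have [->|xv] := pselect (x = v); first by left; exact: branch_refl.
have [->|xv'] := pselect (x = v'); first by right; exact: branch_refl.
case: IH => IH; [left|right]; apply: (branch_trans _ IH); apply: joined_step => //.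
  move=> zv'; rewrite zv' in IH.
  by have [/esym//|[nv' _]] := joined_mem IH; exact: nv'.
move=> zv; rewrite zv in IH.
by have [//|[nv _]] := joined_mem IH; exact: nv.
Qed.

Lemma joined_neighbor U v y : joined_in T U y v -> y <> v ->
  exists w, [/\ U w, T (v, w) & joined_in T (U `\ v) y w].
Proof.
move: y; apply: joined_walk_ind => // x z Ux Uz Txz _ IH xv.
have [zv|zv] := pselect (z = v).
  by exists x; split; [|apply: sT; rewrite -zv|exact: joined_refl].
have [w [Uw vw zw]] := IH zv; exists w; split => //.
by apply: joined_trans zw; exact: joined_step.
Qed.

Lemma branch_neighbor v y : connectedness T (v, y) -> y <> v ->
  exists2 w, T (v, w) & branch T v y w.
Proof.
move=> /connectedness_sym yv /(joined_neighbor yv)[w [_ vw yw]].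
by exists w => //; apply: joined_sub yw => z [].
Qed.

End branches_of_graph.

Section tree.
Context {X : choiceType} (T : set (X * X)).
Context (gT : is_graph T) (aT : acyclic T).
Implicit Types (U W : set X) (v w x y z : X) (r s : nat -> X).

Let sT x y : T (x, y) -> T (y, x). Proof. by case: gT => _; apply. Qed.
Let irT x : ~ T (x, x). Proof. by case: gT => + _; apply. Qed.

(** Two distinct neighbours of [v] joined off [v] would close up a cycle. *)
Lemma branch_neighbor_inj v w w' : T (v, w) -> T (v, w') -> branch T v w w' ->
  w = w'.
Proof.
move=> vw vw' ww'; apply: contrapT => neq.
pose e : rel X := fun x y => `[< [/\ x != v, y != v & T (x, y)] >].
have [p pe pw] : exists2 p, path e w p & w' = last w p.
  move: w ww' {vw neq}; apply: joined_walk_ind; first by exists [::].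
  move=> x z xv zv Txz _ [p pe pw]; exists (z :: p) => //=; rewrite pe andbT.
  by apply/asboolP; split => //; apply/eqP.
case: (shortenP pe) pw => q qe uq _ {p pe} qw.
have wv : w != v by apply/eqP => wv; move: vw; rewrite wv; exact: irT.
have vq : v \notin w :: q.
  rewrite inE negb_or eq_sym wv /=; elim: q w qe {vw ww' neq uq qw wv} => //= a q IH w.
  by move=> /andP[/asboolP[_ av _] /IH]; rewrite inE negb_or eq_sym av.
apply: aT; exists (size q).+1, (nth v (v :: w :: q)); split.
- by case: q qw {qe uq vq} => //= ww0; case: neq.
- move=> i j; rewrite !inE => iq jq /eqP; rewrite nth_uniq ?ltnS//.
    by move=> /eqP.
  by rewrite cons_uniq vq uq.
- case=> [_|i]; first exact: vw.
  rewrite ltnS => iq; have /(pathP v)/(_ i iq)/asboolP[_ _] := qe.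
  by [].
- by rewrite /= nth_last /= -qw; exact: sT.
Qed.

(** A vertex in both sides of the edge [(v, w)] would be joined off [w] to a
    neighbour of [w] other than [v], and to [v]. *)
Lemma branch_disjoint v w y : T (v, w) -> branch T v w y -> ~ branch T w v y.
Proof.
move=> vw wy vy; have [yw|yw] := pselect (y = w).
  apply: (branch_notin _ (_ : branch T w v w)); last by rewrite -{2}yw.
  by move=> vw'; move: vw; rewrite vw'; exact: irT.
have [u [uv wu yu]] := joined_neighbor gT (branch_sym gT wy) yw.
apply: uv; apply: esym; apply: (branch_neighbor_inj (sT vw) wu).
apply: branch_trans vy _; apply: joined_sub yu => z [_]; exact.
Qed.

Lemma branch_nested v w u : T (v, w) -> T (w, u) -> u <> v ->
  branch T w u `<=` branch T v w.
Proof.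
move=> vw wu uv y uy.
have wv : w <> v by move=> wv; move: vw; rewrite wv; exact: irT.
have wy : connectedness T (w, y).
  by apply: connectedness_trans (branch_connected uy); exact: connectedness_edge.
have [//|vy] := branch_cover gT wv wy.
exfalso; apply: uv; apply: (branch_neighbor_inj wu (sT vw)).
exact: (branch_trans uy (branch_sym gT vy)).
Qed.

Lemma branch_half_space v w : T (v, w) -> half_space T (branch T v w).
Proof.
move=> vw; have wv : w <> v by move=> wv; move: vw; rewrite wv; exact: irT.
split=> [x y wx wy|].
  have xy : branch T v x y by exact: branch_trans (branch_sym gT wx) wy.
  move: x xy wx; apply: joined_walk_ind => [_|x z xv zv Txz _ IH wx].
    exact: joined_refl.
  have wz : branch T v w z by apply: branch_trans wx _; exact: joined_step.
  exact: joined_trans (joined_step wx wz Txz) (IH wz).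
exists (w, v); split=> [|[p q] [/= wp nwq Tpq]].
  by split; [exact: branch_refl|exact: branch_notin|exact: sT].
have pv : p <> v.
  by move=> pv; rewrite pv in wp; exact: (branch_notin wv wp).
have [qv|qv] := pselect (q = v); last first.
  by exfalso; apply: nwq; apply: branch_trans wp _; exact: joined_step.
by rewrite qv in Tpq *; rewrite (branch_neighbor_inj vw (sT Tpq) wp).
Qed.

Section ray.
Context r (rT : forall n, T (r n, r n.+1)) (rb : forall n, r n.+2 <> r n).

Let tail n := branch T (r n) (r n.+1).

Lemma ray_tail_sub m n : (m <= n)%N -> tail n `<=` tail m.
Proof.
move=> /subnKC <-; elim: (n - m)%N => [|k IH]; first by rewrite addn0.
rewrite addnS; apply: subset_trans IH; exact: branch_nested.
Qed.

Lemma ray_tail_mem m n : (m < n)%N -> tail m (r n).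
Proof.
case: n => // n; rewrite ltnS => /ray_tail_sub; apply; exact: branch_refl.
Qed.

Let ray_tail_notin n : ~ tail n (r n).
Proof.
by apply: branch_notin => rn; apply: (@irT (r n)); rewrite -{2}rn.
Qed.

Lemma nonbacktracking_inj : injective r.
Proof.
have lt m n : (m < n)%N -> r m <> r n.
  by move=> /ray_tail_mem mn rmn; apply: (@ray_tail_notin m); rewrite rmn.
move=> m n rmn; have [/lt|/lt/nesym|//] := ltngtP m n; by move/(_ rmn).
Qed.

Lemma ray_connected m n : connectedness T (r m, r n).
Proof.
suff r0 k : connectedness T (r 0%N, r k).
  exact: connectedness_trans (connectedness_sym gT (r0 m)) (r0 n).
elim: k => [|k IH]; first exact: connectedness_refl.
by apply: connectedness_trans IH _; exact: connectedness_edge.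
Qed.

(** A neighbour of a vertex outside the [n]-th tail is outside it too, unless
    that vertex is [r n]; since the ray is injective, this happens once. *)
Lemma ray_tail_escape p : connectedness T (r 0%N, p) ->
  exists N, forall n, (N <= n)%N -> ~ tail n p.
Proof.
move=> /(connectedness_sym gT); move: p; apply: joined_walk_ind.
  by exists 0%N => n n0 /(ray_tail_sub n0); exact: ray_tail_notin.
move=> q p _ _ Tqp _ [N NP].
have [[m pm]|pr] := pselect (exists m, p = r m).
  exists (maxn N m.+1) => n; rewrite geq_max => /andP[Nn mn] qn.
  apply: (NP n Nn); apply: (branch_trans qn); apply: joined_step => //= [qrn|].
    by apply: (@ray_tail_notin n); rewrite -qrn.
  by rewrite pm => /nonbacktracking_inj mn'; rewrite mn' ltnn in mn.
exists N => n Nn qn; apply: (NP n Nn); apply: (branch_trans qn).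
apply: joined_step => //= [qrn|prn]; last by apply: pr; exists n.
by apply: (@ray_tail_notin n); rewrite -qrn.
Qed.

(** Once the inner end [p] of the only edge leaving [U] is outside the tail, no
    walk in the tail can leave [U]. *)
Lemma half_space_ray_tail U : half_space T U ->
  (exists m, forall k, U (r (m + k)%N)) ->
  exists N, forall n, (N <= n)%N -> tail n `<=` U.
Proof.
move=> [cU [[p q] [[/= Up nUq Tpq] pq1]]] [m mU].
have Urm : U (r m) by rewrite -(addn0 m).
have [N NP] := ray_tail_escape (connectedness_trans (ray_connected 0 m)
  (joined_setT (cU _ _ Urm Up))).
exists (maxn N m) => n; rewrite geq_max => /andP[Nn mn] y.
have Urn : U (r n.+1) by rewrite -(subnKC (leqW mn)).
move=> /(branch_sym gT); move: y; apply: joined_walk_ind => // x z xr zr Txz zrn Uz.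
apply: contrapT => nUx.
have [pz _] := pq1 (z, x) (And3 Uz nUx (sT Txz)).
by apply: (NP n Nn); rewrite pz; exact: (branch_sym gT).
Qed.

End ray.

Lemma ray_nonbacktracking r : ray T r -> forall n, r n.+2 <> r n.
Proof. by move=> [rinj _] n /rinj/eqP; rewrite -addn2 -{2}(addn0 n) eqn_add2l. Qed.

End tree.

(** * Ends, small branches and vanishing *)

Section ends.
Context {X : choiceType} (T : set (X * X)).
Context (gT : is_graph T) (aT : acyclic T).
Implicit Types (U V : set X) (r s : nat -> X).

Let tail r n := branch T (r n) (r n.+1).

Lemma end_of_ray_shift r n : ray T r -> end_of_ray T r (fun k => r (n + k)%N).
Proof.
move=> [rinj rT]; split.
  split=> [i j /rinj/eqP|i]; first by rewrite eqn_add2l => /eqP.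
  by rewrite addnS; exact: rT.
by exists n, 0%N => k; rewrite add0n.
Qed.

Lemma ray_tail_half_space r n : ray T r -> half_space T (tail r n).
Proof. by move=> [_ rT]; exact: branch_half_space. Qed.

Lemma ray_tail_end_in r n : ray T r -> end_in (end_of_ray T r) (tail r n).
Proof.
move=> rr; exists (fun k => r (n.+1 + k)%N); first exact: end_of_ray_shift.
have [_ rT] := rr.
move=> k; apply: ray_tail_mem (ray_nonbacktracking rr) _ _ _ => //.
by rewrite addSn ltnS leq_addr.
Qed.

Lemma half_space_end_in_tail r U : ray T r -> half_space T U ->
  end_in (end_of_ray T r) U -> exists N, forall n, (N <= n)%N -> tail r n `<=` U.
Proof.
move=> rr hU [s [rs [m [m' ms]]] sU]; have [_ rT] := rr.
apply: (half_space_ray_tail gT aT rT (ray_nonbacktracking rr) hU).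
by exists m => k; rewrite ms.
Qed.

(** A member of the filter contains a finite intersection of half-spaces around
    the end, and each of these contains all late tails. *)
Lemma end_filter_tail r V : ray T r -> end_filter T (end_of_ray T r) V ->
  exists N, forall n, (N <= n)%N -> tail r n `<=` V.
Proof.
move=> rr [_ [D DU <-] DV].
have /choice[f fP] U : exists N, half_space T U /\ end_in (end_of_ray T r) U ->
    forall n, (N <= n)%N -> tail r n `<=` U.
  have [[hU eU]|nU] := pselect (half_space T U /\ end_in (end_of_ray T r) U).
    by have [N NP] := half_space_end_in_tail rr hU eU; exists N.
  by exists 0%N => /nU.
exists (\max_(U <- enum_fset D) f U)%N => n Dn y ny; apply: DV => U /= UD.
apply: (fP U) ny; first by have := DU _ UD; rewrite inE.
by apply: leq_trans Dn; exact: (@leq_bigmax_seq _ _ xpredT f).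
Qed.

Lemma end_filter_half_space_tail r U n : ray T r -> half_space T U ->
  end_in (end_of_ray T r) U -> end_filter T (end_of_ray T r) (U `&` tail r n).
Proof.
move=> rr hU eU; exists (U `&` tail r n) => //.
apply: finI_fromI; apply: (@finI_from1 _ _ _ id); split => //.
  exact: ray_tail_half_space.
exact: ray_tail_end_in.
Qed.

Lemma finite_ray_tail_escape r F : ray T r -> finite_set F ->
  (forall y, F y -> connectedness T (r 0%N, y)) ->
  exists N, forall y, F y -> ~ tail r N y.
Proof.
move=> rr /finite_seqP[s Fs] Fr; have [_ rT] := rr.
have rb := ray_nonbacktracking rr.
have /choice[f fP] y : exists N, F y -> forall n, (N <= n)%N -> ~ tail r n y.
  have [Fy|nFy] := pselect (F y); last by exists 0%N.
  by have [N NP] := ray_tail_escape gT aT rT rb (Fr y Fy); exists N.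
exists (\max_(y <- s) f y)%N => y Fy; apply: (fP y) => //.
by apply: (@leq_bigmax_seq _ _ xpredT f) => //; move: Fy; rewrite Fs.
Qed.

End ends.

Section small_branches.
Context {X : choiceType} (T : set (X * X)) (gT : is_graph T) (aT : acyclic T).
Context (small : set (set X)).
Context (small_sub : forall A B : set X, A `<=` B -> small B -> small A).
Context (smallU : forall A B : set X, small A -> small B -> small (A `|` B)).
Implicit Types (v w y : X).

Definition small_part v : set X :=
  [set y | [/\ connectedness T (v, y), y <> v & small (branch T v y)]].

(** Suppose that [v] and [v'] are distinct. If the branch at [v] towards [v'] does
    not contain [a], then the branch at [v'] containing [a] contains every branch
    at [v] except the one towards [v'], so the small part of [v] is covered by two
    small sets. If both the branch at [v] towards [v'] and the branch at [v']
    towards [v] contain [a], they are small and cover the whole component. *)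
Lemma large_small_part_unique v v' a : ~ small (small_part v) ->
  ~ small (small_part v') -> small_part v a -> small_part v' a -> v = v'.
Proof.
have half u u' : u <> u' -> ~ small (small_part u) ->
    small_part u a -> small_part u' a -> branch T u u' a.
  move=> uu' lu [ua au sau] [u'a au' sau'].
  have [a1|//] := branch_cover gT uu' ua; exfalso; apply: lu.
  have s1 : small (branch T u' u).
    by rewrite (branch_eq gT a1).
  have [s2|ns2] := pselect (small (branch T u u')).
    apply: (small_sub _ (smallU s1 s2)) => y [uy _ _].
    by have [] := branch_cover gT uu' uy; [left|right].
  apply: small_sub s1 => y [uy _ sy].
  have [//|u'y] := branch_cover gT uu' uy.
  by exfalso; apply: ns2; rewrite (branch_eq gT u'y).
move=> lv lv' va v'a; apply: contrapT => vv'.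
have h := half _ _ vv' lv va v'a.
have h' := half _ _ (nesym vv') lv' v'a va.
have [c0 _ s1] := va; have [c1 _ s2] := v'a.
apply: lv; rewrite -(branch_eq gT h) in s1; rewrite -(branch_eq gT h') in s2.
apply: (small_sub _ (smallU s2 s1)) => y [vy _ _].
by have [] := branch_cover gT vv' vy; [left|right].
Qed.

(** If no small part is large, a large branch continues along a further edge to
    a large branch, since otherwise it would be the union of its first vertex
    and of a subset of a small part. *)
Lemma large_branch_ray x : ~ small (eclass (connectedness T) x) ->
  (forall v, connectedness T (x, v) -> small [set v] /\ small (small_part v)) ->
  exists2 r, ray T r /\ r 0%N = x &
    forall n, ~ small (branch T (r n) (r n.+1)).
Proof.
move=> lx xs.
have next v A : connectedness T (x, v) -> ~ small A ->
    A `<=` eclass (connectedness T) v ->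
    exists y w, [/\ A y, T (v, w), branch T v y w & ~ small (branch T v w)].
  move=> xv lA Av; apply: contrapT => nyw; apply: lA.
  have [sv spv] := xs v xv; apply: (small_sub _ (smallU sv spv)) => y Ay.
  have [->|yv] := pselect (y = v); [by left|right; split => //; first exact: Av].
  have [w vw yw] := branch_neighbor gT (Av _ Ay) yv.
  apply: contrapT => ls; apply: nyw; exists y, w; split => //.
  by rewrite -(branch_eq gT yw).
pose good (e : X * X) :=
  [/\ connectedness T (x, e.1), T e & ~ small (branch T e.1 e.2)].
have /choice[f fP] e : exists w, good e -> good (e.2, w) /\ w <> e.1.
  case: e => v w; have [[/= xv vw lw]|ng] := pselect (good (v, w)); last by exists v.
  have xw : connectedness T (x, w).
    exact: connectedness_trans xv (connectedness_edge vw).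
  have [y [u [wy wu yu lu]]] := next w _ xw lw (@branch_connected _ T v w).
  exists u => _; split; first by split.
  move=> uv; apply: (branch_disjoint gT aT vw wy).
  by rewrite -uv; exact: (branch_sym gT).
have [y [w [_ xw _ lw]]] := next x _ (connectedness_refl T x) lx (fun y yx => yx).
pose e := fix e n := if n is m.+1 then ((e m).2, f (e m)) else (x, w).
have eg n : good (e n).
  by elim: n => [|n IH]; [split => //=; exact: connectedness_refl|case: (fP _ IH)].
have rT n : T ((e n).1, (e n.+1).1).
  by have [_ Te _] := eg n; rewrite /= -surjective_pairing.
have rb n : (e n.+2).1 <> (e n).1 by have [_ nb] := fP _ (eg n).
exists (fun n => (e n).1); last by move=> n; have [_ _] := eg n.
by split=> //; split=> //; exact: (nonbacktracking_inj gT aT rT rb).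
Qed.

End small_branches.

Section vanishing.
Context {R : realType} {d : measure_display} {X : measurableType d}.
Context (T : set (X * X)) (gT : is_graph T) (aT : acyclic T).
Context (rho : X * X -> R).
Context (rho_gt0 : forall p, connectedness T p -> 0 < rho p).
Implicit Types (r : nat -> X).

Lemma finite_esum_ge (I : choiceType) (D : set I) (a : I -> R) (e : R) :
  0 < e -> (forall i, D i -> 0 <= a i) -> (\esum_(i in D) (a i)%:E < +oo)%E ->
  finite_set [set i | D i /\ e <= a i].
Proof.
move=> e0 a0 Doo; apply: contrapT => inf.
have s0 : (0 <= \esum_(i in D) (a i)%:E)%E.
  by apply: esum_ge0 => i Di; rewrite lee_fin a0.
have [M sM] : exists M : R, (\esum_(i in D) (a i)%:E)%E = M%:E.
  by exists (fine (\esum_(i in D) (a i)%:E)%E); rewrite fineK// ge0_fin_numE.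
have [A AD An] := infinite_set_fset (Num.truncn (M / e)).+1 inf.
have : ((e *+ (size (enum_fset A)))%:E <= \esum_(i in D) (a i)%:E)%E.
  apply: esum_ge; exists [set` A] => /=; first by split=> // i /AD[].
  rewrite fsbig_finite//= set_fsetK sumEFin lee_fin.
  have -> : e *+ size (enum_fset A) = \sum_(i <- enum_fset A) e.
    by rewrite big_const_seq count_predT iter_addr_0.
  by rewrite big_seq [leRHS]big_seq; apply: ler_sum => i iA; case: (AD i iA).
rewrite sM lee_fin leNgt => /negP; apply.
rewrite -mulr_natl -ltr_pdivrMr//; apply: (lt_le_trans (truncnS_gt _)).
by rewrite ler_nat.
Qed.

Lemma rho_finite_abarytropic x : rho_finite rho x (eclass (connectedness T) x) ->
  forall xi, end_at T x xi -> abarytropic T rho x xi.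
Proof.
move=> fx _ [r [rr xr ->]]; exists (branch T (r 0%N) (r 1%N)); split.
- exact: ray_tail_half_space.
- exact: ray_tail_end_in.
- apply: le_lt_trans fx; apply: le_ereal_sup => _ [A [finA AU] <-].
  exists A => //; split => // y /AU ry; apply: connectedness_trans (xr 1%N) _.
  exact: (branch_connected ry).
Qed.

(** Only finitely many vertices of a finite-weight half-space have weight at
    least [e], and a tail of the ray avoids them. *)
Lemma abarytropic_vanishing x xi : end_at T x xi -> abarytropic T rho x xi ->
  vanishing T rho x xi.
Proof.
move=> [r [rr xr ->]] [U [hU eU fU]]; have [_ rT] := rr.
have [N0 N0U] := half_space_end_in_tail gT aT rr hU eU.
have xU y : U y -> connectedness T (x, y).
  move=> Uy; apply: connectedness_trans (xr N0.+1) _.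
  have [cU _] := hU; apply: joined_setT (cU _ _ _ Uy).
  by apply: (N0U N0) => //; exact: branch_refl.
have U0 y : U y -> 0 < rho (y, x).
  by move=> /xU/(connectedness_sym gT)/rho_gt0.
apply/eqP; rewrite eq_le; apply/andP; split.
  apply/lee_addgt0Pr => e e0; rewrite add0e.
  have fF := finite_esum_ge e0 (fun y Uy => ltW (U0 y Uy)) fU.
  have [|N NP] := finite_ray_tail_escape gT aT rr fF.
    move=> y [Uy _]; apply: connectedness_trans (xU y Uy).
    exact: (connectedness_sym gT).
  apply: (@le_trans _ _ (ereal_sup ((fun y => (rho (y, x))%:E) @`
      (U `&` branch T (r N) (r N.+1))))).
    apply: ereal_inf_lbound; exists (U `&` branch T (r N) (r N.+1)) => //.
    exact: end_filter_half_space_tail.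
  apply: ge_ereal_sup => _ [y [Uy Ny] <-]; rewrite lee_fin.
  by rewrite leNgt; apply/negP => /ltW ey; exact: (NP y).
apply: le_ereal_inf_tmp => _ [V VF <-].
have [N NV] := end_filter_tail gT aT rr VF.
apply: (@le_trans _ _ (rho (r N.+1, x))%:E).
  rewrite lee_fin; apply/ltW/rho_gt0; exact: (connectedness_sym gT).
apply: ereal_sup_ubound; exists (r N.+1) => //.
by apply: (NV N) => //; exact: branch_refl.
Qed.

Lemma vanishing_ray_tail x r (c : R) : ray T r -> 0 < c ->
  vanishing T rho x (end_of_ray T r) ->
  exists N, forall y, branch T (r N) (r N.+1) y -> rho (y, x) < c.
Proof.
move=> rr c0 vx.
have : (ereal_inf [set ereal_sup ((fun y => (rho (y, x))%:E) @` V)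
    | V in end_filter T (end_of_ray T r)] < c%:E)%E by rewrite vx lte_fin.
move=> /ereal_inf_lt[_ [V VF <-]] Vc.
have [N NV] := end_filter_tail gT aT rr VF; exists N => y Ny.
rewrite -lte_fin; apply: le_lt_trans Vc; apply: ereal_sup_ubound.
by exists y => //; exact: (NV N).
Qed.

End vanishing.

(** * Enumerating almost every class *)

Section measurable_maps.
Context {dY d : measure_display} {Y : measurableType dY} {X : measurableType d}.
Implicit Types (g h : Y -> X).

Lemma measurable_preimage g (C : set X) : measurable_fun setT g -> measurable C ->
  measurable [set x | C (g x)].
Proof. by move=> mg mC; rewrite -[mkset _]setTI; exact: mg. Qed.

Lemma measurable_pair g h (A : set (X * X)) : measurable_fun setT g ->
  measurable_fun setT h -> measurable A -> measurable [set x | A (g x, h x)].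
Proof.
move=> mg mh mA; rewrite -[mkset _]setTI.
exact: (measurable_fun_pair mg mh).
Qed.

Lemma measurable_eq (U : nat -> set X) g h : (forall n, measurable (U n)) ->
  (forall x y, (forall n, U n x <-> U n y) -> x = y) ->
  measurable_fun setT g -> measurable_fun setT h ->
  measurable [set x | g x = h x].
Proof.
move=> mU sepU mg mh.
rewrite (_ : mkset _ = [set x | forall n, (U n (g x) -> U n (h x)) /\
                                         (U n (h x) -> U n (g x))]).
  apply: measurable_forall => n; apply: measurable_and;
    by apply: measurable_imply; exact: measurable_preimage.
apply/seteqP; split=> [x /= ->//|x /= gh]; apply: sepU => n.
by split; case: (gh n).
Qed.

End measurable_maps.

Section class_enumeration.
Context {R : realType} {d : measure_display} {X : measurableType d}.
Context (mu : probability X R) (T : set (X * X)).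
Local Notation E := (connectedness T).

(** The saturation of a null set is contained in a measurable null set, but this
    set need not be invariant, so the construction is iterated. *)
Lemma invariant_null_set N : is_graph T -> mcp mu E -> measurable N -> mu N = 0%E ->
  exists Z, [/\ measurable Z, mu Z = 0%E, N `<=` Z &
    forall x y, E (x, y) -> Z x -> Z y].
Proof.
move=> gT mcpE mN N0.
have /choice[f fP] A : exists B, measurable A -> mu A = 0%E ->
    [/\ measurable B, mu B = 0%E & saturation E A `<=` B].
  have [[mA A0]|nA] := pselect (measurable A /\ mu A = 0%E); last first.
    by exists set0 => mA A0; case: nA.
  have /mcpE[B [mB B0 AB]] : mu.-negligible A by apply/negligibleP.
  by exists B.
have itP n : measurable (iter n f N) /\ mu (iter n f N) = 0%E.
  by elim: n => [//|n [mA A0]]; have [] := fP _ mA A0.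
exists (\bigcup_n iter n f N); split.
- by apply: bigcup_measurable => n _; case: (itP n).
- apply/negligibleP; first by apply: bigcup_measurable => n _; case: (itP n).
  by apply: negligible_bigcup => n; apply/negligibleP; case: (itP n).
- by move=> x Nx; exists 0%N.
- move=> x y xy [n _ Zx]; exists n.+1 => //=; have [mA A0] := itP n.
  by have [_ _] := fP _ mA A0; apply; exists x.
Qed.

(** The maps [G n] are the compositions of the maps whose graphs cover [T]. *)
Lemma class_enumeration : standard_borel R X -> is_graph T -> measurable T ->
  locally_countable T -> mcp mu E ->
  exists (Z : set X) (G : nat -> X -> X),
    [/\ measurable Z /\ mu Z = 0%E, forall x y, E (x, y) -> Z x -> Z y,
        forall n, measurable_fun setT (G n), forall n x, E (x, G n x) &
        forall x y, ~ Z x -> E (x, y) -> exists n, G n x = y].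
Proof.
move=> sX gT mT cT mcpE.
have [N [g [mN N0 mg gT']]] := lusin_novikov_std mu sX mT cT.
have [Z [mZ Z0 NZ Zinv]] := invariant_null_set gT mcpE mN N0.
pose step n x := if pselect (T (x, g n x)) then g n x else x.
have mstep n : measurable_fun setT (step n).
  move=> _ C mC; rewrite setTI (_ : _ @^-1` _ =
    [set x | (T (x, g n x) /\ C (g n x)) \/ (~ T (x, g n x) /\ C x)]).
    have mTg : measurable [set x | T (x, g n x)].
      by apply: measurable_pair => //; exact: measurable_id.
    apply: measurable_or; apply: measurable_and => //.
      exact: measurable_preimage.
    exact: measurable_not.
  apply/seteqP; split=> x; rewrite /step /=; case: pselect => Tg /=.
  - by left.
  - by right.
  - by case=> [[]|[]].
  - by case=> [[]|[]].
pose word := foldr (fun n h => step n \o h) id.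
have mword w : measurable_fun setT (word w).
  elim: w => [|n w IH] /=; first exact: measurable_id.
  exact: measurableT_comp.
have Eword w x : E (x, word w x).
  elim: w => [|n w IH] /=; first exact: connectedness_refl.
  rewrite /step; case: pselect => Tg //=.
  by apply: connectedness_trans IH _; exact: connectedness_edge.
have wordE x y : ~ Z x -> E (x, y) -> exists w, word w x = y.
  move=> nZx /(connectedness_sym gT).
  move: y; apply: joined_walk_ind; first by exists [::].
  move=> y z _ _ Tyz zx [w wz].
  have nNz : ~ N z by move=> /NZ Zz; apply: nZx; exact: Zinv zx Zz.
  have Tzy : T (z, y) by case: gT => _; apply.
  have [n gz] := gT' z y Tzy nNz.
  exists (n :: w) => /=; rewrite wz /step gz.
  by case: pselect.
exists Z, (fun n => word (odflt [::] (unpickle n))); split => //.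
by move=> x y nZx /(wordE x y nZx)[w <-]; exists (pickle w); rewrite pickleK.
Qed.

End class_enumeration.

(** * Mass transport *)

Section lower_integral.
Context {R : realType} {d : measure_display} {X : measurableType d}.
Context (mu : probability X R).
Implicit Types (f g : X -> \bar R).
Local Open Scope ereal_scope.
Import HBNNSimple.

Lemma ge0_le_integral_any f g : (forall x, 0 <= f x) -> (forall x, f x <= g x) ->
  \int[mu]_x f x <= \int[mu]_x g x.
Proof.
move=> f0 fg; have g0 x : 0 <= g x by exact: le_trans (f0 x) (fg x).
rewrite !ge0_integralTE//; apply: le_ereal_sup => _ [h hf <-].
by exists h => //= x; exact: le_trans (hf x) (fg x).
Qed.

Lemma integral_pinfty_null f (W : set X) : (forall x, 0 <= f x) -> measurable W ->
  (forall x, W x -> f x = +oo) -> \int[mu]_x f x <= 1 -> mu W = 0.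
Proof.
move=> f0 mW fW f1; apply/eqP; rewrite eq_le measure_ge0 andbT.
have kW (k : nat) : k%:R%:E * mu W <= 1.
  apply: le_trans f1; rewrite -(setIT W) -integral_indic// -integralZl_indic//.
    2: by rewrite ltNge ler0n.
  apply: ge0_le_integral_any => x.
    by rewrite lee_fin mulr_ge0// indicE ler0n.
  rewrite indicE; have [Wx|nWx] := pselect (W x).
    by rewrite fW// leey.
  by rewrite memNset// mulr0.
have muf : mu W \is a fin_num by exact: fin_num_measure.
rewrite -(fineK muf) lee_fin leNgt; apply/negP => W0.
have /= := truncnS_gt (fine (mu W))^-1; rewrite ltNge => /negP; apply.
by rewrite -[leRHS]mul1r ler_pdivlMr// -lee_fin EFinM fineK.
Qed.

(** The integral of a nonnegative function is the supremum of the integrals of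
    the simple functions below it, whether or not the function is measurable,
    so it ignores every set without measurable subsets of positive measure. *)
Lemma lower_integral_le f (W : set X) (c : R) : (0 <= c)%R -> (forall x, 0 <= f x) ->
  (forall A, measurable A -> A `<=` W -> mu A = 0) ->
  (forall x, ~ W x -> f x <= c%:E) -> \int[mu]_x f x <= c%:E.
Proof.
move=> c0 f0 W0 fc; rewrite ge0_integralTE//; apply: ge_ereal_sup => _ [h hf <-].
have -> : sintegral mu h = \int[mu]_x (h x)%:E.
  by rewrite integral_nnsfun// patch_setT.
pose A := [set x | (c < h x)%R].
have mA : measurable A.
  rewrite (_ : A = h @^-1` `]c, +oo[%classic); first exact: measurable_funPTI.
  by apply/seteqP; split=> x; rewrite /A /= in_itv /= andbT.
have AW : A `<=` W.
  move=> x /= cx; apply: contrapT => /fc fx.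
  have := le_trans (hf x) fx; rewrite lee_fin => hc.
  by move: cx; rewrite /A /= ltNge hc.
have -> : c%:E = \int[mu]_x (cst c%:E x) :> \bar R.
  rewrite integral_cst// -[LHS]mule1; congr (_ * _).
  by rewrite -(probability_setT mu).
apply: ae_ge0_le_integral => //.
- by move=> x _; rewrite lee_fin.
- by apply/measurable_EFinP; exact: measurable_funPT.
- exists A; split => //; first exact: W0.
  move=> x /= nx; rewrite /A /= ltNge; apply/negP => hc; apply: nx => _.
  by rewrite lee_fin.
Qed.

Lemma measurable_kernel (N : set X) : exists K, [/\ measurable K, K `<=` N &
  forall A, measurable A -> A `<=` N -> mu (A `\` K) = 0].
Proof.
apply: (exhaustion mu (F := fun A => A `<=` N)) => //.
by move=> W WN; apply: bigcup_sub => n _; case: (WN n).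
Qed.

End lower_integral.

Section mass_transport.
Context {R : realType} {d : measure_display} {X : measurableType d}.
Context (mu : probability X R) (T : set (X * X)) (rho : X * X -> R).
Local Notation E := (connectedness T).
Context (gT : is_graph T) (rnE : radon_nikodym_cocycle mu E rho).
Local Open Scope ereal_scope.

Let rho_gt0 p : E p -> (0 < rho p)%R. Proof. by case: rnE => _ + _ _; apply. Qed.

(** [H (y, v)] means that [y] sends its unit mass to [v]; masses arriving at [v]
    are measured in units of the weight of [v]. *)
Definition received (H : set (X * X)) (v : X) : \bar R :=
  \esum_(y in [set y | E (v, y) /\ H (y, v)]) (rho (y, v))%:E.

Definition single_valued (H : set (X * X)) := forall x y y', E (x, y) ->
  E (x, y') -> H (x, y) -> H (x, y') -> y = y'.

Lemma received_ge0 H v : 0 <= received H v.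
Proof.
apply: esum_ge0 => y [vy _]; rewrite lee_fin; apply/ltW/rho_gt0.
exact: connectedness_sym vy.
Qed.

Lemma esum_single_valued H x : single_valued H ->
  \esum_(y in eclass E x) (if (x, y) \in H then 1 else 0) <= 1 :> \bar R.
Proof.
move=> sH; rewrite (eq_esum (b := fun y => if y \in [set y | H (x, y)] then 1 else 0)).
  rewrite -esum_mkcondr; set A := _ `&` _.
  have [[y Ay]|nA] := pselect (A !=set0).
    rewrite (_ : A = [set y]) ?esum_set1//.
    apply/seteqP; split=> [z [xz xzH]|_ ->//].
    by have [xy xyH] := Ay; exact: sH xz xy xzH xyH.
  rewrite (_ : A = set0) ?esum_set0//; apply/seteqP; split=> // y Ay.
  by case: nA; exists y.
move=> y _; have [Hxy|nHxy] := pselect (H (x, y)); first by rewrite !mem_set.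
by rewrite !memNset.
Qed.

Lemma transport_eq H (h := fun p : X * X => if p \in H then 1 else 0 : \bar R) :
  measurable_fun E h ->
  \int[mu]_x (\esum_(y in eclass E x) (if (x, y) \in H then 1 else 0)) =
  \int[mu]_x received H x.
Proof.
move=> mh; have [_ _ _ /(_ h mh) RN] := rnE.
rewrite -[LHS]/(\int[mu]_x (\esum_(y in eclass E x) h (x, y))) RN; last first.
  by move=> p _; rewrite /h; case: ifP.
apply: eq_integral => v _; rewrite /received.
rewrite (_ : [set y | _] = eclass E v `&` [set y | H (y, v)])// esum_mkcondr.
apply: eq_esum => y _; rewrite /h; have [Hyv|nHyv] := pselect (H (y, v)).
  by rewrite !mem_set// mul1e.
by rewrite !memNset// mul0e.
Qed.

(** The enumeration of classes writes the mass received as a series of measurable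
    functions, off a null set. *)
Lemma measurable_received H : standard_borel R X -> measurable T ->
  locally_countable T -> mcp mu E -> measurable E -> measurable H ->
  exists Z : set X, [/\ measurable Z, mu Z = 0 &
    measurable [set v | ~ Z v /\ received H v = +oo]].
Proof.
move=> sX mT cT mcpE mE mH.
have [Z [G [[mZ Z0] Zinv mG EG GE]]] := class_enumeration sX gT mT cT mcpE.
have [U mU sepU] := standard_borel_separated sX.
(* Only the first index at which each point of the class of [v] is enumerated
   is retained. *)
pose D n := [set v | (forall m, (m < n)%N -> G m v <> G n v) /\ H (G n v, v)].
have mD n : measurable (D n).
  apply: measurable_and; last exact: (measurable_pair (mG n) (@measurable_id _ _ setT)).
  apply: measurable_forall => m; apply: measurable_imply; first exact: measurable_prop.
  by apply: measurable_not; exact: (measurable_eq mU sepU (mG m) (mG n)).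
have mr n : measurable_fun setT (fun v => rho (G n v, v)).
  move=> _ C mC; rewrite setTI.
  rewrite (_ : _ @^-1` _ = [set v | (E `&` rho @^-1` C) (G n v, v)]).
    apply: (measurable_pair (mG n) (@measurable_id _ _ setT)).
    by case: rnE => mrho _ _ _; exact: mrho.
  apply/seteqP; split=> [v Cv|v []//]; split => //.
  exact: connectedness_sym (EG n v).
pose phi n v : \bar R := (\1_(D n) v * rho (G n v, v))%:E.
have phi0 n v : 0 <= phi n v.
  rewrite lee_fin mulr_ge0 ?indicE// ltW// rho_gt0//.
  exact: connectedness_sym (EG n v).
have mphi n : measurable_fun setT (phi n).
  by apply/measurable_EFinP; apply: measurable_funM => //; exact: measurable_indic.
pose S v := \sum_(n <oo) phi n v.
have mS : measurable_fun setT S.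
  by apply: (@ge0_emeasurable_sum _ _ _ _ phi xpredT).
exists Z; split => //.
rewrite (_ : mkset _ = [set v | ~ Z v /\ S v = +oo]).
  apply: measurable_and; first exact: measurable_not.
  by have := mS measurableT _ (emeasurable_set1 +oo); rewrite setTI.
suff SE v : ~ Z v -> received H v = S v.
  by apply/seteqP; split=> v /= [nZ vS]; split => //; [rewrite -SE|rewrite SE].
move=> nZ; rewrite /S nneseries_esumT//.
rewrite /received (reindex_esum [set n | D n v] _ (fun n => G n v)).
  rewrite esum_mkcond; apply: eq_esum => n _; rewrite /phi indicE.
  have [Dn|nDn] := pselect (D n v); first by rewrite !mem_set// mul1r.
  by rewrite !memNset// mul0r.
split.
- by move=> n [_ Hn]; split => //; exact: EG.
- move=> m n; rewrite !inE => -[ltm _] [ltn _] mn.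
  by have [/ltn/(_ mn)|/ltm/(_ (esym mn))|] := ltngtP m n.
- move=> y [vy Hy]; have /GE-/(_ nZ) := vy.
  move=> [n0 n0y]; have ex : exists n, `[< G n v = y >] by exists n0; apply/asboolP.
  case: (ex_minnP ex) => n /asboolP ny nmin; exists n => //; split; last by rewrite ny.
  move=> m mn my; have := nmin m; rewrite leqNgt mn => /(_ _)/negP; apply => //.
  by apply/asboolP; rewrite my.
Qed.

(** The mass transport principle. If every vertex sends its unit mass to at most
    one vertex of its class, then almost every vertex receives a finite mass.
    When [E] is not measurable, the cocycle identity constrains every function on
    [E]; letting the vertices of [S] that receive a finite mass send an infinite
    mass to themselves, where [S] is a measurable hull of the other vertices,
    makes the mass received infinite on all of [S] and does not change the lower
    integral of the mass sent. *)
Theorem mass_transport H : standard_borel R X -> measurable T ->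
  locally_countable T -> mcp mu E -> measurable H -> single_valued H ->
  mu.-negligible [set v | received H v = +oo].
Proof.
move=> sX mT cT mcpE mH sH.
have le1 x := esum_single_valued x sH.
have ge0 x : 0 <= \esum_(y in eclass E x) (if (x, y) \in H then 1 else 0) :> \bar R.
  by apply: esum_ge0 => y _; case: ifP.
have [mE|nmE] := pselect (measurable E).
  have [Z [mZ Z0 mN]] := measurable_received sX mT cT mcpE mE mH.
  have N0 : mu [set v | ~ Z v /\ received H v = +oo] = 0.
    apply: (integral_pinfty_null (received_ge0 H) mN); first by move=> x [].
    rewrite -transport_eq; last first.
      apply: (measurable_funS measurableT) => //.
      rewrite (_ : (fun _ => _) = EFin \o \1_H).
        by apply/measurable_EFinP; exact: measurable_indic.
      by apply/funext => p /=; rewrite indicE; case: (p \in H).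
    apply: (lower_integral_le (W := set0)) => // A _.
    by rewrite subset0 => ->.
  apply: negligibleS (negligibleU ((negligibleP mu mZ).2 Z0)
    ((negligibleP mu mN).2 N0)) => v vH.
  by have [Zv|nZv] := pselect (Z v); [left|right].
set N := [set v | _]; have [K [mK KN Kmax]] := measurable_kernel mu (~` N).
exists (~` K); split; [exact: measurableC| |by move=> v Nv /KN; apply].
(* The set [B] contains no measurable set of positive measure. *)
pose B := ~` K `\` N.
have B0 A : measurable A -> A `<=` B -> mu A = 0.
  move=> mA AB; rewrite -(Kmax _ mA); last by move=> x /AB[].
  by congr (mu _); apply/seteqP; split=> [x Ax|x []//]; split => //; case: (AB x Ax).
pose h (p : X * X) : \bar R := (if p \in H then 1 else 0) +
  (if `[< p.1 = p.2 /\ B p.1 >] then +oo else 0).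
have h0 p : 0 <= h p.
  by apply: adde_ge0; case: ifP.
have [_ _ _ /(_ h)] := rnE; rewrite /measurable_fun => /(_ _ (fun p _ => h0 p)) RN.
have {RN} := RN (fun mE => False_ind _ (nmE mE)).
move=> RN; apply: (@integral_pinfty_null _ _ _ mu
  (fun x => \esum_(y in eclass E x) (h (y, x) * (rho (y, x))%:E))).
- move=> x; apply: esum_ge0 => y xy; rewrite mule_ge0// lee_fin; apply/ltW/rho_gt0.
  exact: connectedness_sym xy.
- exact: measurableC.
- move=> x nKx; apply/eqP; rewrite -leye_eq.
  have [Nx|nNx] := pselect (N x).
    rewrite -[leLHS]Nx /received.
    rewrite (_ : [set y | _] = eclass E x `&` [set y | H (y, x)])// esum_mkcondr.
    apply: le_esum => y xy; have yx := rho_gt0 (connectedness_sym gT xy).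
    case: ifPn => [|_]; last by rewrite mule_ge0// lee_fin ltW.
    rewrite inE /= => yxH; rewrite -[leLHS]mul1e; apply: lee_wpmul2r.
      by rewrite lee_fin ltW.
    by rewrite /h mem_set// leeDl//; case: ifP.
  apply: esum_ge; exists [set x].
    by split; [exact: finite_set1|move=> _ ->; exact: connectedness_refl].
  rewrite fsbig_set1 /h asboolT// addey; last by case: ifP.
  by rewrite gt0_mulye// lte_fin; apply: rho_gt0; exact: connectedness_refl.
- rewrite -RN; apply: (lower_integral_le (W := B)) => // x.
    by apply: esum_ge0 => y _; exact: h0.
  move=> nBx; apply: le_trans (le1 x); apply: le_esum => y _.
  by rewrite /h asboolF ?adde0// => -[].
Qed.

End mass_transport.

(** * Negligible subsets of a class *)

Section class_definable.
Context {R : realType} {d : measure_display} {X : measurableType d}.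
Context (T : set (X * X)) (rho : X * X -> R).
Local Notation E := (connectedness T).
Context (gT : is_graph T) (mT : measurable T).
Context (mE : measurable E) (mrho : measurable_fun E rho).
Context (Z : set X) (G : nat -> X -> X).
Context (mZ : measurable Z) (mG : forall n, measurable_fun setT (G n)).
Context (EG : forall n x, E (x, G n x)).
Context (GE : forall x y, ~ Z x -> E (x, y) -> exists n, G n x = y).
Context (U : nat -> set X) (mU : forall n, measurable (U n)).
Context (sepU : forall x y, (forall n, U n x <-> U n y) -> x = y).
Implicit Types (p q : X -> Prop) (A : X -> X -> Prop).

(** Off [Z] every class is enumerated by the maps [G n], so quantifiers over the
    class of a point preserve measurability. *)
Definition definable p := measurable [set v | ~ Z v /\ p v].

Lemma definable_ext p q : (forall v, ~ Z v -> p v <-> q v) -> definable p ->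
  definable q.
Proof.
move=> pq; rewrite /definable; congr measurable.
by apply/seteqP; split=> v [nZ /(pq v nZ)].
Qed.

Lemma definable_measurable p : measurable [set v | p v] -> definable p.
Proof. by move=> mp; apply: measurable_and => //; exact: measurable_not. Qed.

Lemma definable_not p : definable p -> definable (fun v => ~ p v).
Proof.
move=> mp; rewrite /definable.
rewrite (_ : mkset _ = ~` Z `\` [set v | ~ Z v /\ p v]).
  by apply: measurableD => //; exact: measurableC.
apply/seteqP; split=> [v [nZ np]|v [nZ np]]; split => //; first by case.
by move=> pv; apply: np.
Qed.

Lemma definable_exists (I : countType) (F : I -> X -> Prop) :
  (forall i, definable (F i)) -> definable (fun v => exists i, F i v).
Proof.
move=> mF; rewrite /definable.
rewrite (_ : mkset _ = [set v | exists i, ~ Z v /\ F i v]).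
  exact: measurable_exists.
apply/seteqP; split=> [v [nZ [i Fi]]|v [i [nZ Fi]]]; first by exists i.
by split => //; exists i.
Qed.

Lemma definable_and p q : definable p -> definable q ->
  definable (fun v => p v /\ q v).
Proof.
move=> mp mq; rewrite /definable.
rewrite (_ : mkset _ = [set v | ~ Z v /\ p v] `&` [set v | ~ Z v /\ q v]).
  exact: measurableI.
by apply/seteqP; split=> [v [nZ []]|v [[? ?] [? ?]]].
Qed.

Lemma definable_imply p q : definable p -> definable q ->
  definable (fun v => p v -> q v).
Proof.
move=> mp mq; apply: (definable_ext (p := fun v => ~ (p v /\ ~ q v))).
  move=> v _; split=> [npq pv|pq [pv]]; last by apply; exact: pq.
  by apply: contrapT => nq; apply: npq.
by apply: definable_not; apply: definable_and => //; exact: definable_not.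
Qed.

Lemma definable_forall (I : countType) (F : I -> X -> Prop) :
  (forall i, definable (F i)) -> definable (fun v => forall i, F i v).
Proof.
move=> mF; apply: (definable_ext (p := fun v => ~ exists i, ~ F i v)).
  by move=> v _; split=> [/forallNP nF i|vF [i]]; [exact: contrapT|apply].
by apply/definable_not/definable_exists => i; exact: definable_not.
Qed.

Lemma definable_exists_class A : (forall n, definable (fun v => A v (G n v))) ->
  definable (fun v => exists z, E (v, z) /\ A v z).
Proof.
move=> mA; apply: (definable_ext (p := fun v => exists n, A v (G n v))).
  move=> v nZ; split=> [[n An]|[z [/(GE nZ)[n <-] An]]]; last by exists n.
  by exists (G n v).
exact: definable_exists.
Qed.

Lemma definable_finite A : (forall n, definable (fun v => A v (G n v))) ->
  definable (fun v => finite_set [set y | E (v, y) /\ A v y]).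
Proof.
move=> mA; apply: (definable_ext (p := fun v => exists k, forall n, A v (G n v) ->
    exists m, (m < k)%N /\ G m v = G n v)).
  move=> v nZ; split=> [[k kP]|/finite_seqP[s sP]].
    apply: (sub_finite_set (B := (fun n => G n v) @` `I_k)).
      move=> y [/(GE nZ)[n <-] /kP[m [mk mn]]].
      by exists m.
    exact/finite_image/finite_II.
  have /choice[f fP] y : exists n, E (v, y) -> G n v = y.
    have [vy|nvy] := pselect (E (v, y)); last by exists 0%N.
    by have [n ny] := GE nZ vy; exists n.
  exists (\max_(y <- s) f y).+1 => n An; exists (f (G n v)); split; last exact: fP.
  rewrite ltnS; apply: (@leq_bigmax_seq _ _ xpredT f) => //.
  have : [set y | E (v, y) /\ A v y] (G n v) by split.
  by rewrite sP.
apply: definable_exists => k; apply: definable_forall => n; apply: definable_imply => //.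
apply: definable_exists => m; apply: definable_and; apply: definable_measurable.
  exact: measurable_prop.
exact: measurable_eq mU sepU (mG m) (mG n).
Qed.

Lemma definable_rho (C : set R) i j : measurable C ->
  definable (fun v => C (rho (G i v, G j v))).
Proof.
move=> mC; apply: definable_measurable.
rewrite (_ : mkset _ = [set v | (E `&` rho @^-1` C) (G i v, G j v)]).
  by apply: (measurable_pair (mG i) (mG j)); exact: mrho.
apply/seteqP; split=> [v Cv|v []//]; split => //=.
by apply: connectedness_trans (EG j v); apply: connectedness_sym (EG i v).
Qed.

Let walk := fix walk k v y z := if k is l.+1 then exists n,
  [/\ y <> v, G n v <> v & T (y, G n v)] /\ walk l v (G n v) z else y = z :> X.

(** Joined off [v] means joined by a walk of some finite length, with vertices in
    the countable class of [v]. *)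
Lemma definable_branch i j : definable (fun v => branch T v (G i v) (G j v)).
Proof.
apply: (definable_ext (p := fun v => exists k, walk k v (G i v) (G j v))).
  move=> v nZ; split.
    move=> [k]; move: (G i v) (EG i v) => y; elim: k y => [|k IH] y vy /=.
      by move=> ->; exact: branch_refl.
    move=> [n [[yv nv yn] nj]]; apply: (branch_trans (joined_step _ _ yn)) => //.
    exact: IH.
  move: (G i v) (EG i v) => y vy yj.
  move: y yj vy; apply: joined_walk_ind; first by exists 0%N.
  move=> x z xv zv Txz _ IH vx.
  have vz : E (v, z) by apply: connectedness_trans vx (connectedness_edge Txz).
  have [n nz] := GE nZ vz; have [k kP] := IH vz.
  by exists k.+1 => /=; exists n; rewrite nz.
apply: definable_exists => k; elim: k i => [|k IH] i /=.
  by apply: definable_measurable; exact: measurable_eq mU sepU (mG i) (mG j).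
apply: definable_exists => n; apply: definable_and; last exact: IH.
have nv m : definable (fun v => G m v <> v).
  apply/definable_not/definable_measurable.
  exact: (measurable_eq mU sepU (mG m) (@measurable_id _ _ setT)).
apply: (definable_ext (p := fun v => G i v <> v /\ G n v <> v /\ T (G i v, G n v))).
  by move=> v _; split=> [[? []]|[]].
apply: definable_and => //; apply: definable_and => //.
by apply: definable_measurable; exact: (measurable_pair (mG i) (mG n)).
Qed.

End class_definable.

Section negligible_weight.
Context {R : realType} {d : measure_display} {X : measurableType d}.
Context (T : set (X * X)) (rho : X * X -> R).
Local Notation E := (connectedness T).
Context (gT : is_graph T).
Context (rho_gt0 : forall p, E p -> 0 < rho p).
Context (rhoM : forall x y z, E (x, y) -> E (y, z) ->
  rho (z, y) * rho (y, x) = rho (z, x)).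
Implicit Types (v x y z : X) (A B : set X).

Lemma cocycle_refl x : rho (x, x) = 1.
Proof.
have xx : E (x, x) := connectedness_refl T x.
have x0 : rho (x, x) != 0 by rewrite gt_eqF// rho_gt0.
by apply: (mulfI x0); rewrite rhoM// mulr1.
Qed.

Lemma cocycleV x y : E (x, y) -> rho (x, y) = (rho (y, x))^-1.
Proof.
move=> xy; have yx := connectedness_sym gT xy.
have r0 : rho (y, x) != 0 by rewrite gt_eqF// rho_gt0.
by apply: (mulIf r0); rewrite rhoM// mulVf// cocycle_refl.
Qed.

(** Levels are given by the weights of vertices, so that quantifying over them
    is quantifying over a countable class. *)
Definition heavier z : set X := [set y | E (z, y) /\ 1 <= rho (y, z)].

(** The idea is that the weights have a smaller superior limit along [A] than
    along the class; comparing the numbers of vertices above a level expresses it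
    in the same way for bounded and for unbounded weights. *)
Definition negligible_weight v A := exists z, E (v, z) /\
  (~ finite_set (heavier z) /\ finite_set (A `&` heavier z)).

Lemma negligible_weight_class x y A : E (x, y) ->
  negligible_weight x A -> negligible_weight y A.
Proof.
move=> xy [z [xz zP]]; exists z; split => //.
exact: connectedness_trans (connectedness_sym gT xy) xz.
Qed.

Lemma negligible_weight_classE x y : E (x, y) ->
  negligible_weight x = negligible_weight y.
Proof.
move=> xy; apply/seteqP; split=> A; apply: negligible_weight_class => //.
exact: connectedness_sym.
Qed.

Lemma negligible_weight_sub v A B : A `<=` B ->
  negligible_weight v B -> negligible_weight v A.
Proof.
move=> AB [z [vz [iz fz]]]; exists z; split => //; split => //.
by apply: sub_finite_set fz; exact: setSI.
Qed.

Lemma heavier_sub z z' : E (z, z') -> 1 <= rho (z', z) ->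
  heavier z' `<=` heavier z.
Proof.
move=> zz' r1 y [z'y ry]; split; first exact: connectedness_trans zz' z'y.
by rewrite -(rhoM zz' z'y) -[leLHS]mulr1 ler_pM.
Qed.

(** The sets of heavier vertices are linearly ordered by inclusion; of two levels
    that witness negligibility, the higher one serves for both sets. *)
Lemma negligible_weightU v A B : negligible_weight v A -> negligible_weight v B ->
  negligible_weight v (A `|` B).
Proof.
suff wlg z z' (C D : set X) : E (v, z) -> E (v, z') -> 1 <= rho (z', z) ->
    finite_set (C `&` heavier z) ->
    ~ finite_set (heavier z') -> finite_set (D `&` heavier z') ->
    finite_set ((C `|` D) `&` heavier z').
  move=> [z [vz [iz fz]]] [z' [vz' [iz' fz']]].
  have zz' := connectedness_trans (connectedness_sym gT vz) vz'.
  have [r1|r1] := leP 1 (rho (z', z)).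
    by exists z'; split => //; split => //; exact: (wlg z z').
  exists z; split => //; split => //; rewrite setUC; apply: (wlg z' z) => //.
  by rewrite (cocycleV zz') invf_ge1 ?ltW// rho_gt0//; exact: connectedness_sym.
move=> vz vz' r1 fz _ fz'; rewrite setIUl finite_setU; split => //.
apply: sub_finite_set fz; apply: setIS; apply: heavier_sub => //.
exact: connectedness_trans (connectedness_sym gT vz) vz'.
Qed.

(** Only finitely many vertices of a set of finite weight reach the level of
    [z]. *)
Lemma negligible_weight_esum v z A : E (v, z) -> ~ finite_set (heavier z) ->
  A `<=` eclass E v -> (\esum_(y in A) (rho (y, v))%:E < +oo)%E ->
  negligible_weight v A.
Proof.
move=> vz iz Av fA; exists z; split => //; split => //.
have c0 : 0 < rho (z, v) by apply: rho_gt0; exact: connectedness_sym.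
apply: sub_finite_set (finite_esum_ge c0 _ fA).
  move=> y [Ay [zy ry]]; split => //; rewrite -(rhoM vz zy).
  by rewrite -[leLHS]mul1r ler_wpM2r// ltW.
by move=> y /Av/(connectedness_sym gT)/rho_gt0/ltW.
Qed.

End negligible_weight.

(** * Smoothness, abarytropic ends and vanishing ends *)

Section smoothness.
Context {R : realType} {d : measure_display} {X : measurableType d}.
Context (mu : probability X R) (T : set (X * X)) (rho : X * X -> R).
Local Notation E := (connectedness T).
Context (sX : standard_borel R X) (gT : is_graph T) (mT : measurable T)
  (aT : acyclic T) (cT : locally_countable T) (mcpE : mcp mu E)
  (rnE : radon_nikodym_cocycle mu E rho).

Let rho_gt0 p : E p -> 0 < rho p. Proof. by case: rnE => _ + _ _; apply. Qed.
Let rhoM x y z : E (x, y) -> E (y, z) -> rho (z, y) * rho (y, x) = rho (z, x).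
Proof. by case: rnE => _ _ + _; apply. Qed.

Lemma negligible_invariant (N : set X) : mu.-negligible N ->
  exists Z, [/\ measurable Z, mu Z = 0%E, N `<=` Z &
    forall x y, E (x, y) -> Z x -> Z y].
Proof.
move=> [A [mA A0 NA]]; have [Z [mZ Z0 AZ Zinv]] := invariant_null_set gT mcpE mA A0.
by exists Z; split => //; exact: subset_trans AZ.
Qed.

Lemma rho_finite_change x y (D : set X) : E (x, y) -> D `<=` eclass E x ->
  rho_finite rho y D -> rho_finite rho x D.
Proof.
move=> xy Dx fy; have Dy z : D z -> E (y, z).
  by move=> /Dx; apply: connectedness_trans; exact: connectedness_sym.
have s0 : (0 <= \esum_(z in D) (rho (z, y))%:E)%E.
  apply: esum_ge0 => z /Dy/(connectedness_sym gT)/rho_gt0/ltW.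
  by rewrite lee_fin.
apply: (@le_lt_trans _ _ ((\esum_(z in D) (rho (z, y))%:E) * (rho (y, x))%:E)%E).
  apply: ge_ereal_sup => _ [A [finA AD] <-].
  rewrite (eq_fsbigr (fun z => (rho (z, y) * rho (y, x))%:E)); last first.
    by move=> z; rewrite inE => /AD/Dy yz; rewrite rhoM.
  rewrite fsumEFin// -mulr_fsuml EFinM; apply: lee_wpmul2r.
    by rewrite lee_fin ltW// rho_gt0//; exact: connectedness_sym.
  by rewrite -fsumEFin//; apply: ereal_sup_ubound; exists A.
rewrite muleC lte_mul_pinfty// lee_fin ltW// rho_gt0//.
exact: connectedness_sym.
Qed.

(** Let every vertex send its mass to the point of the transversal in its class:
    that point receives the weight of the class. *)
Lemma smooth_rho_finite : smooth_ae mu E ->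
  {ae mu, forall x, rho_finite rho x (eclass E x)}.
Proof.
move=> [Y [S [mY Y0 mS SY YS]]].
have sYS : single_valued T (Y `*` S).
  move=> x y y' xy xy' [/= Yx Sy] [_ Sy'].
  have [s [_ s1]] := YS x Yx.
  by rewrite -(s1 y)// -(s1 y').
have mYS : measurable (Y `*` S) by exact: measurableX.
have N0 := mass_transport gT rnE sX mT cT mcpE mYS sYS.
have nY0 : mu.-negligible (~` Y) by apply/negligibleP => //; exact: measurableC.
apply: negligibleS (mcpE (negligibleU N0 nY0)) => x nfx.
apply: contrapT => nW; apply: nfx => /=.
have xY y : E (x, y) -> Y y.
  move=> xy; apply: contrapT => nYy; apply: nW; exists y; first by right.
  exact: connectedness_sym.
have [s [[Ss xs] _]] := YS x (xY x (connectedness_refl T x)).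
apply: (rho_finite_change xs) => //.
rewrite /rho_finite ltey; apply/eqP => sinf; apply: nW.
exists s; last exact: connectedness_sym.
left => /=; rewrite -[RHS]sinf; congr (\esum_(y in _) _)%E.
apply/seteqP; split=> [y [sy _]|y xy]; first exact: connectedness_trans xs sy.
split; first exact: connectedness_trans (connectedness_sym gT xs) xy.
by split => //; exact: xY.
Qed.

(** A cocycle identity valid for all functions on [E] forces smoothness: apply it
    to the projection to an arbitrary transversal [S]. The classes that miss the
    inner measurable kernel of [S] send their mass to a set without measurable
    subsets of positive measure, so they form a null set. *)
Lemma smooth_of_nonmeasurable : ~ measurable E -> smooth_ae mu E.
Proof.
move=> nmE.
have [Z [G [[mZ Z0] Zinv mG EG GE]]] := class_enumeration sX gT mT cT mcpE.
pose rep x := xget point (eclass E x).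
have Erep x : E (x, rep x).
  by rewrite /rep; case: xgetP => [y -> //|/(_ x)[]]; exact: connectedness_refl.
have rep_eq x y : E (x, y) -> rep x = rep y.
  move=> xy; rewrite /rep; congr (xget point _); apply/seteqP; split=> z.
    exact/connectedness_trans/connectedness_sym.
  exact: connectedness_trans.
pose S := [set x | rep x = x].
have [K [mK KS Kmax]] := measurable_kernel mu S.
pose C := [set v | ~ Z v /\ forall n, ~ K (G n v)].
have mC : measurable C.
  apply: measurable_and; first exact: measurable_not.
  by apply: measurable_forall => n; apply: measurable_not; exact: measurable_preimage.
have C_inv v w : E (v, w) -> C v -> C w.
  move=> vw [nZ nK]; split=> [Zw|n Kn].
    by apply: nZ; apply: Zinv Zw; exact: connectedness_sym.
  have [m mE] := GE _ _ nZ (connectedness_trans vw (EG n w)).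
  by apply: (nK m); rewrite mE.
have mu_C : mu C = 0%E.
  pose h (p : X * X) : \bar R := if `[< C p.1 /\ S p.2 >] then 1%E else 0%E.
  have h0 p : (0 <= h p)%E by rewrite /h; case: ifP.
  have [_ _ _ /(_ h)] := rnE; rewrite /measurable_fun => /(_ _ (fun p _ => h0 p)) RN.
  have {}RN := RN (fun mE => False_ind _ (nmE mE)).
  apply/eqP; rewrite eq_le measure_ge0 andbT.
  apply: (@le_trans _ _ (\int[mu]_x \esum_(y in eclass E x) h (x, y))%E).
    rewrite -(setIT C) -integral_indic//; apply: ge0_le_integral_any => x.
      by rewrite lee_fin.
    rewrite indicE; have [Cx|nCx] := pselect (C x); last first.
      by rewrite memNset//; apply: esum_ge0.
    rewrite mem_set//; apply: esum_ge; exists [set rep x].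
      by split; [exact: finite_set1|move=> _ ->; exact: Erep].
    rewrite fsbig_set1 /h asboolT//; split => //=.
    by rewrite /S /= -(rep_eq x).
  rewrite RN; apply: (lower_integral_le (W := S `&` C)) => //.
  - move=> x; apply: esum_ge0 => y xy; rewrite mule_ge0// lee_fin ltW// rho_gt0//.
    exact: connectedness_sym.
  - move=> A mA ASC; rewrite -(Kmax A mA) => [|x /ASC[]//].
    congr (mu _); apply/seteqP; split=> [x Ax|x []//]; split => // Kx.
    have [_ [nZ nK]] := ASC x Ax.
    by have [n nx] := GE _ _ nZ (connectedness_refl T x); apply: (nK n); rewrite nx.
  - move=> x nSC; rewrite esum1// => y xy; rewrite /h asboolF ?mul0e//= => -[Cy Sx].
    by apply: nSC; split => //; apply: C_inv Cy; exact: connectedness_sym.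
pose Y := [set v | ~ Z v /\ exists n, K (G n v)].
have KY v : K v -> ~ Z v -> Y v.
  move=> Kv nZ; split => //; have [n nv] := GE _ _ nZ (connectedness_refl T v).
  by exists n; rewrite nv.
exists Y, (K `\` Z); split.
- apply: measurable_and; first exact: measurable_not.
  by apply: measurable_exists => n; exact: measurable_preimage.
- apply: (subset_measure0 (B := Z `|` C)).
  + apply: measurableC; apply: measurable_and; first exact: measurable_not.
    by apply: measurable_exists => n; exact: measurable_preimage.
  + exact: measurableU.
  + move=> v nY; have [Zv|nZ] := pselect (Z v); [by left|right; split => // n Kn].
    by apply: nY; split => //; exists n.
  + have mZC := measurableU _ _ mZ mC.
    apply/(negligibleP mu mZC)/negligibleU; exact/negligibleP.
- exact: measurableD.
- by move=> v [Kv nZ]; exact: KY.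
- move=> x [nZ [n Kn]]; exists (G n x); split.
    split; last exact: EG.
    by split => // Zn; apply: nZ; apply: Zinv Zn; exact: connectedness_sym (EG n x).
  move=> s [[Ks _] xs]; rewrite -(KS _ Ks) -(KS _ Kn) -(rep_eq _ _ xs).
  exact: esym (rep_eq _ _ (EG n x)).
Qed.

Section measurable_relation.
Context (mE : measurable E).

Let mrho : measurable_fun E rho. Proof. by case: rnE. Qed.

(** Let a vertex send its mass to the vertices whose small part is not
    negligible but contains it; there is at most one such vertex. A small part
    that receives a finite mass is negligible. *)
Lemma ae_small_part_negligible : {ae mu, forall v,
  (exists z, E (v, z) /\ ~ finite_set (heavier T rho z)) ->
  negligible_weight T rho v (small_part T (negligible_weight T rho v) v)}.
Proof.
have [Z [G [[mZ Z0] Zinv mG EG GE]]] := class_enumeration sX gT mT cT mcpE.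
have [U mU sepU] := standard_borel_separated sX.
pose P v y := small_part T (negligible_weight T rho v) v y /\
  ~ negligible_weight T rho v (small_part T (negligible_weight T rho v) v).
have def_fin := definable_finite mZ mG EG GE mU sepU.
have def_heavier i j : definable Z (fun v => 1 <= rho (G i v, G j v)).
  rewrite (_ : (fun v => _) = (fun v => [set r | 1 <= r] (rho (G i v, G j v))))//.
  apply: (definable_rho gT mE mrho mZ mG EG i j).
  rewrite (_ : [set r : R | _] = `[1, +oo[%classic); first exact: measurable_itv.
  by apply/seteqP; split=> r /=; rewrite in_itv /= andbT.
have def_neg (A : X -> X -> Prop) : (forall n, definable Z (fun v => A v (G n v))) ->
    definable Z (fun v => negligible_weight T rho v (A v)).
  move=> mA; pose B v z := ~ finite_set [set y | E (v, y) /\ 1 <= rho (y, z)] /\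
    finite_set [set y | E (v, y) /\ (A v y /\ 1 <= rho (y, z))].
  apply: (definable_ext (p := fun v => exists z, E (v, z) /\ B v z)).
    move=> v nZ.
    have BE z : E (v, z) -> B v z = (~ finite_set (heavier T rho z) /\
        finite_set (A v `&` heavier T rho z)).
      move=> vz; have vzE y : E (v, y) <-> E (z, y).
        split; first exact/connectedness_trans/connectedness_sym.
        exact: connectedness_trans.
      have -> : A v `&` heavier T rho z =
          [set y | E (v, y) /\ (A v y /\ 1 <= rho (y, z))].
        by apply/seteqP; split=> [y [Ay [/vzE vy ry]]|y [/vzE zy [Ay ry]]].
      rewrite /B (_ : heavier T rho z = [set y | E (v, y) /\ 1 <= rho (y, z)])//.
      by apply/seteqP; split=> y [/vzE ? ?].
    by split=> -[z [vz zP]]; exists z; split => //; move: zP; rewrite BE.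
  apply: (definable_exists_class EG GE) => i; apply: definable_and.
    by apply: definable_not => //; apply: def_fin => j; exact: def_heavier.
  by apply: def_fin => j; apply: definable_and => //; exact: def_heavier.
have def_small n : definable Z (fun v =>
    small_part T (negligible_weight T rho v) v (G n v)).
  apply: (definable_ext (p := fun v => G n v <> v /\
      negligible_weight T rho v (branch T v (G n v)))).
    by move=> v _; split=> [[? ?]|[]] //; split => //; exact: EG.
  apply: definable_and; last first.
    by apply: def_neg => j; exact: (definable_branch mT mZ mG EG GE mU sepU).
  apply: definable_not => //; apply: definable_measurable => //.
  exact: (measurable_eq mU sepU (mG n) (@measurable_id _ _ setT)).
have mP n : measurable [set v | ~ Z v /\ P v (G n v)].
  apply: definable_and; first exact: def_small.
  by apply: definable_not => //; exact: def_neg.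
pose H := [set p : X * X | exists n, p.1 = G n p.2 /\ (~ Z p.2 /\ P p.2 (G n p.2))].
have mH : measurable H.
  apply: measurable_exists => n; apply: measurable_and.
    apply: (measurable_eq mU sepU measurable_fst).
    exact: measurableT_comp (mG n) measurable_snd.
  exact: (measurable_preimage measurable_snd (mP n)).
have HP y v : H (y, v) -> ~ Z v /\ P v y by move=> [n [/= -> ]].
have sH : single_valued T H.
  move=> x v v' xv xv' /HP[_ [av lv]] /HP[_ [av' lv']].
  rewrite -(negligible_weight_classE rho gT xv) in av lv.
  rewrite -(negligible_weight_classE rho gT xv') in av' lv'.
  apply: (large_small_part_unique gT _ _ lv lv' av av').
    exact: negligible_weight_sub.
  exact: negligible_weightU.
have N0 := mass_transport gT rnE sX mT cT mcpE mH sH.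
apply: negligibleS (negligibleU N0 ((negligibleP mu mZ).2 Z0)) => v nv.
have [Zv|nZ] := pselect (Z v); [by right|left => /=].
apply: contrapT => fv; apply: nv => /= -[z [vz iz]]; apply: contrapT => nneg.
apply: (nneg); apply: (negligible_weight_esum gT rho_gt0 rhoM vz iz) => [y []//|].
rewrite ltey; apply/eqP => sinf; apply: fv; rewrite -sinf.
congr (\esum_(y in _) _)%E; apply/seteqP; split=> y.
  by move=> [_ /HP[_ []]].
move=> sy; have [vy _ _] := sy; split => //.
have [n ny] := GE _ _ nZ vy; exists n => /=; split => //; rewrite ny; split => //.
Qed.

End measurable_relation.
End smoothness.

Lemma finite_argmax {R : realType} {X : choiceType} (F : set X) (f : X -> R) :
  finite_set F -> F !=set0 -> exists2 m, F m & forall y, F y -> f y <= f m.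
Proof.
move=> /finite_seqP[s ->] {F}; elim: s => [[]//|a s IH _].
have [/IH[m ms mmax]|s0] := pselect ([set` s] !=set0); last first.
  exists a => /=; first by rewrite inE eqxx.
  by move=> y; rewrite /= inE => /predU1P[->//|ys]; case: s0; exists y.
have [fam|fma] := leP (f a) (f m).
  exists m => /=; first by rewrite inE [m \in s]ms orbT.
  by move=> y; rewrite /= inE => /predU1P[->//|/mmax].
exists a => /=; first by rewrite inE eqxx.
by move=> y; rewrite /= inE => /predU1P[->//|/mmax/le_trans]; apply; exact: ltW.
Qed.

Section transversal.
Context {R : realType} {d : measure_display} {X : measurableType d}.
Context (mu : probability X R) (T : set (X * X)) (rho : X * X -> R).
Local Notation E := (connectedness T).
Context (sX : standard_borel R X) (gT : is_graph T) (mT : measurable T)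
  (aT : acyclic T) (cT : locally_countable T) (mcpE : mcp mu E)
  (rnE : radon_nikodym_cocycle mu E rho).

Let rho_gt0 p : E p -> 0 < rho p. Proof. by case: rnE => _ + _ _; apply. Qed.
Let rhoM x y z : E (x, y) -> E (y, z) -> rho (z, y) * rho (y, x) = rho (z, x).
Proof. by case: rnE => _ _ + _; apply. Qed.

(** In a class with infinitely many vertices above some level but only negligible
    small parts there is a ray all of whose tails contain vertices above that
    level, so its end does not vanish. *)
Lemma ae_heavier_finite : measurable E ->
  {ae mu, forall x, forall xi, end_at T x xi -> vanishing T rho x xi} ->
  {ae mu, forall x, finite_set (heavier T rho x)}.
Proof.
move=> mE van.
have small := ae_small_part_negligible sX gT mT cT mcpE rnE mE.
apply: negligibleS (mcpE (negligibleU van small)) => x /= iz.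
apply: contrapT => nW; apply: iz; apply: contrapT => iz.
have xW v : E (x, v) ->
    (forall xi, end_at T v xi -> vanishing T rho v xi) /\
    ((exists z, E (v, z) /\ ~ finite_set (heavier T rho z)) ->
      negligible_weight T rho v (small_part T (negligible_weight T rho v) v)).
  move=> xv; split; apply: contrapT => nv; apply: nW; exists v; [by left|
    exact: connectedness_sym|by right|exact: connectedness_sym].
have xx : E (x, x) := connectedness_refl T x.
have [|||v xv|r [rr r0] rl] :=
  @large_branch_ray _ T gT aT (negligible_weight T rho x) _ _ x.
- exact: negligible_weight_sub.
- exact: (negligible_weightU gT rho_gt0 rhoM).
- by move=> [z [xz [inf fin]]]; apply: inf; apply: sub_finite_set fin => y [zy ry];
    split => //; exact: connectedness_trans xz zy.
- split.
    exists x; split => //; split => //.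
    by apply: sub_finite_set (finite_set1 v) => y [].
  rewrite (negligible_weight_classE rho gT xv); apply: (xW v xv).2.
  by exists x; split => //; exact: connectedness_sym.
have rx : end_at T x (end_of_ray T r).
  exists r; split => // n; rewrite -r0; case: rr => _ rT.
  exact: (ray_connected gT rT).
have [N NP] := vanishing_ray_tail gT aT rr ltr01 ((xW x xx).1 _ rx).
apply: (rl N); exists x; split => //; split => //.
apply: sub_finite_set (finite_set0 X) => y [/NP ry [_]].
by rewrite leNgt ry.
Qed.

(** The heaviest vertices form a measurable set with finite nonempty traces on
    classes, from which a sequence of sets separating points selects one point of
    each class. *)
Lemma smooth_of_heavier_finite : measurable E ->
  {ae mu, forall x, finite_set (heavier T rho x)} -> smooth_ae mu E.
Proof.
move=> mE fin.
have [Z0 [G [[mZ0 mu0] _ mG EG GE]]] := class_enumeration sX gT mT cT mcpE.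
have [U mU sepU] := standard_borel_separated sX.
have [Z [mZ muZ sZ Zinv]] := negligible_invariant gT mcpE
  (negligibleU fin ((negligibleP mu mZ0).2 mu0)).
have {}GE x y : ~ Z x -> E (x, y) -> exists n, G n x = y.
  by move=> nZ; apply: GE => Z0x; apply: nZ; apply: sZ; right.
have {}fin x : ~ Z x -> finite_set (heavier T rho x).
  by move=> nZ; apply: contrapT => nf; apply: nZ; apply: sZ; left.
have {sZ} nZ_inv x y : E (x, y) -> ~ Z x -> ~ Z y.
  by move=> xy nZ Zy; apply: nZ; apply: Zinv Zy; exact: connectedness_sym.
pose M0 := [set v | forall n, rho (G n v, v) <= 1].
have mM0 : measurable M0.
  apply: measurable_forall => n.
  rewrite (_ : mkset _ = [set v | (E `&` rho @^-1` `]-oo, 1]%classic) (G n v, v)]).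
    apply: (measurable_pair (mG n) (@measurable_id _ _ setT)).
    by case: rnE => mrho _ _ _; apply: mrho => //; exact: measurable_itv.
  apply/seteqP; split=> [v /= rv|v [_]] /=; last by rewrite in_itv.
  by split; [exact: connectedness_sym (EG n v)|rewrite in_itv].
(* Stage [k] retains the points of [U k], in each class where there are any. *)
pose M := fix M k := if k is l.+1 then
  [set v | M l v /\ (U l v \/ forall n, ~ (M l (G n v) /\ U l (G n v)))] else M0.
have mM k : measurable (M k).
  elim: k => [|k IH] //=; apply: measurable_and; first exact: IH.
  apply: measurable_or; first exact: mU.
  apply: measurable_forall => n; apply: measurable_not.
  by apply: measurable_and; exact: measurable_preimage.
have MS k l : (k <= l)%N -> M l `<=` M k.
  by move=> /subnKC <-; elim: (l - k)%N => [|n IH]; rewrite ?addn0// addnS => v [/IH].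
have M0x x : ~ Z x -> exists2 v, E (x, v) & M0 v.
  move=> nZ; have [|v [xv rv] vmax] := finite_argmax (fun y => rho (y, x)) (fin x nZ).
    by exists x; split; [exact: connectedness_refl|rewrite (cocycle_refl rho_gt0 rhoM)].
  exists v => // n; have vG := EG n v; have xG := connectedness_trans xv vG.
  have v0 : 0 < rho (v, x) by apply: rho_gt0; exact: connectedness_sym.
  rewrite -(ler_pM2r v0) mul1r (rhoM xv vG).
  have [r1|/ltW r1] := leP 1 (rho (G n v, x)); first exact: vmax.
  exact: le_trans r1 rv.
have Mx x k : ~ Z x -> exists2 v, E (x, v) & M k v.
  move=> nZ; elim: k => [|k [v xv Mv]]; first exact: M0x.
  have [[n [Mn Un]]|nU] := pselect (exists n, M k (G n v) /\ U k (G n v)).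
    by exists (G n v); [exact: connectedness_trans xv (EG n v)|split => //; left].
  by exists v => //; split => //; right=> n Mn; apply: nU; exists n.
exists (~` Z), ((\bigcap_k M k) `\` Z); split.
- exact: measurableC.
- by rewrite setCK.
- by apply: measurableD => //; apply: bigcap_measurableType => k _; exact: mM.
- by move=> v [].
- move=> x nZ.
  have [s xs Ms] : exists2 s, E (x, s) & forall k, M k s.
    apply: contrapT => ns.
    have /finite_seqP[t tP] : finite_set (heavier T rho x) := fin x nZ.
    have /choice[f fP] y : exists k, E (x, y) -> ~ M k y.
      have [[xy My]|nxy] := pselect (E (x, y) /\ forall k, M k y).
        by case: ns; exists y.
      have [xy|nxy'] := pselect (E (x, y)); last by exists 0%N.
      have /existsNP[k nk] : ~ forall k, M k y by move=> My; apply: nxy.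
      by exists k.
    have [v xv Mv] := Mx x (\max_(y <- t) f y)%N nZ.
    have vt : heavier T rho x v.
      split => //; have [n nx] := GE v x (nZ_inv _ _ xv nZ) (connectedness_sym gT xv).
      have := MS 0%N _ (leq0n _) v Mv n; rewrite nx.
      rewrite (cocycleV gT rho_gt0 rhoM xv) invf_le1//.
      by apply: rho_gt0; exact: connectedness_sym.
    apply: (fP v xv); apply: MS Mv; rewrite tP in vt.
    exact: (@leq_bigmax_seq _ _ xpredT f).
  exists s; split; first by split => //; split => //; exact: nZ_inv xs nZ.
  move=> s' [[Ms' nZs'] xs'].
  have sep a b k : ~ Z b -> E (b, a) -> (forall k, M k a) -> (forall k, M k b) ->
      U k a -> U k b.
    move=> nZb ba Ma Mb Ua; have [_ [//|nb]] := Mb k.+1.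
    have [n na] := GE _ _ nZb ba.
    by case: (nb n); rewrite na; split; [exact: Ma|exact: Ua].
  have ss' : E (s, s') by apply: connectedness_trans xs'; exact: connectedness_sym.
  have nZs := nZ_inv _ _ xs nZ.
  have Ms'' k : M k s' by exact: Ms'.
  apply: sepU => k; split; apply: sep => //.
  exact: connectedness_sym.
Qed.

End transversal.

Theorem proposition3p3 (R : realType) (d : measure_display)
    (X : measurableType d) (mu : probability X R)
    (T : set (X * X)) (rho : X * X -> R) :
  standard_borel R X ->
  is_graph T -> measurable T -> acyclic T -> locally_countable T ->
  mcp mu (connectedness T) ->
  radon_nikodym_cocycle mu (connectedness T) rho ->
  (smooth_ae mu (connectedness T) <->
   {ae mu, forall x, forall xi, end_at T x xi -> abarytropic T rho x xi}) /\
  ({ae mu, forall x, forall xi, end_at T x xi -> abarytropic T rho x xi} <->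
   {ae mu, forall x, forall xi, end_at T x xi -> vanishing T rho x xi}).
Proof.
move=> sX gT mT aT cT mcpE rnE.
have rho_gt0 p : connectedness T p -> 0 < rho p by case: rnE => _ + _ _; apply.
have sm_ab : smooth_ae mu (connectedness T) ->
    {ae mu, forall x, forall xi, end_at T x xi -> abarytropic T rho x xi}.
  move=> /(smooth_rho_finite sX gT mT cT mcpE rnE).
  apply: filterS => x; exact: rho_finite_abarytropic.
have ab_van : {ae mu, forall x, forall xi, end_at T x xi -> abarytropic T rho x xi} ->
    {ae mu, forall x, forall xi, end_at T x xi -> vanishing T rho x xi}.
  apply: filterS => x ab xi xe; apply: abarytropic_vanishing => //; exact: ab.
have van_sm : {ae mu, forall x, forall xi, end_at T x xi -> vanishing T rho x xi} ->
    smooth_ae mu (connectedness T).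
  move=> van; have [mE|nmE] := pselect (measurable (connectedness T)).
    apply: (smooth_of_heavier_finite sX gT mT cT mcpE rnE mE).
    exact: (ae_heavier_finite sX gT mT aT cT mcpE rnE mE).
  exact: (smooth_of_nonmeasurable sX gT mT cT mcpE rnE nmE).
split; split=> //.
  by move=> /ab_van/van_sm.
by move=> /van_sm/sm_ab.
Qed.
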